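(* Let $k$ be a field and let $\nu$ be a measure on $\mathfrak{P}$ (the class of finite posets) valued in $k$, with associated matrix $N=(\nu(J_{p,q},\ast))_{0\le p,q\le2}$. The support $\mathfrak{P}_\nu$ of $\nu$ is given by the following table, in terms of which of the matrices in the context equals $N$ or $N^{\top}$ ($s,t\in k$): - $\mathbb{A}(s,t)$: $\mathfrak{A}_t$; - $\mathbb{B}_1(t)$: $\mathfrak{C}_{-t}$; - $\mathbb{B}_2(t)$: $\mathfrak{A}_0$; - $\mathbb{B}_3(t)$: $\mathfrak{A}_t$; - $\mathbb{B}_4(t)$: $\mathfrak{B}_{-t}$; - $\mathbb{B}_5(t)$: $\mathfrak{B}_{-t}$; - $\mathbb{C}_1$: $\mathfrak{A}_0$; $\mathbb{C}_2$: $\mathfrak{B}_1$; $\mathbb{C}_3$: $\mathfrak{A}_0$; $\mathbb{C}_4$: $\mathfrak{A}_0$; $\mathbb{C}_5$: $\mathfrak{A}_0$; $\mathbb{C}_6$: $\mathfrak{A}_1$; $\mathbb{C}_7$: $\mathfrak{A}_0$; $\mathbb{C}_8$: $\mathfrak{A}_1$.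
   Context: All posets are finite; the empty poset is allowed. An embedding of posets is an injective map $\alpha\colon P\to Q$ with $x\le y\iff\alpha(x)\le\alpha(y)$. Given embeddings $\alpha\colon P\to Q$ and $\beta\colon P\to P'$, an amalgamation of $Q$ and $P'$ over $P$ is a triple $(Q',\alpha',\beta')$ where $Q'$ is a poset and $\alpha'\colon P'\to Q'$, $\beta'\colon Q\to Q'$ are embeddings with $\beta'\circ\alpha=\alpha'\circ\beta$ and $Q'=\mathrm{im}(\alpha')\cup\mathrm{im}(\beta')$; amalgamations are considered up to the evident notion of isomorphism. A measure for $\mathfrak{P}$ valued in $k$ is a rule $\nu$ assigning to each embedding $\alpha\colon P\to Q$ of finite posets a value $\nu(\alpha)\in k$ such that: (a) $\nu(\alpha)=1$ if $\alpha$ is an isomorphism; (b) $\nu(\beta\circ\alpha)=\nu(\beta)\nu(\alpha)$ when the composition is defined; (c) given embeddings $\alpha\colon P\to Q$ and $\beta\colon P\to P'$, with $(Q'_i,\alpha'_i,\beta'_i)$, $1\le i\le r$, the various amalgamations up to isomorphism, $\nu(\alpha)=\sum_{i=1}^r\nu(\alpha'_i)$. For $x\in P$ put $\nu(P,x)=\nu(P\setminus\{x\}\to P)$. $J_{p,q}$ is the poset on $\{a_1,\dots,a_p,\ast,b_1,\dots,b_q\}$ with order generated by $a_i<\ast<b_j$. The measure $\nu$ is determined by $N$, and the matrices $N$ that arise are exactly those listed below and their transposes. The support $\mathfrak{P}_\nu$ is the class of finite posets $P$ with $\nu(\emptyset\to P)\ne0$. For $0\le n\le\infty$: $\mathfrak{A}_n$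 is the class of finite antichains with at most $n$ elements. $\mathfrak{B}_n$ is the class of finite posets $X$ with a decomposition $X=X_1\sqcup\cdots\sqcup X_m$, $m\le n$, with each $X_i$ totally ordered and elements of different $X_i$ incomparable. $\mathfrak{C}_n$ is the class of finite posets $X$ with a decomposition $X=X_1\sqcup\cdots\sqcup X_m$ (some $m$) with each $X_i$ an antichain with at most $n$ elements and $a<b$ for all $a\in X_i$, $b\in X_j$, $i<j$. For $t\in k$: if $\mathrm{char}(k)=0$, $\mathfrak{A}_t$ means $\mathfrak{A}_n$ if $t=n\in\mathbf{N}$ (with $0\in\mathbf{N}$), and $\mathfrak{A}_\infty$ otherwise; if $\mathrm{char}(k)>0$, $\mathfrak{A}_t$ means $\mathfrak{A}_n$ if $t$ lies in the prime subfield and $n\in\mathbf{N}$ is the minimal representative of $t$, and $\mathfrak{A}_\infty$ otherwise. $\mathfrak{B}_t$, $\mathfrak{C}_t$ are defined similarly. The matrices (rows and columns indexed by $0,1,2$): $$\mathbb{A}(s,t)=\begin{pmatrix}t&0&0\\0&s&s\\0&s&s\end{pmatrix},\ \mathbb{B}_1(t)=\begin{pmatrix}t&t&t\\t&t&t\\t&t&t\end{pmatrix},\ \mathbb{B}_2(t)=\begin{pmatrix}0&t&t\\0&t&t\\0&t&t\end{pmatrix},$$ $$\mathbb{B}_3(t)=\begin{pmatrix}t&0&0\\0&-1&0\\0&-1&0\end{pmatrix},\ \mathbb{B}_4(t)=\begin{pmatrix}t&-1&0\\-1&-1&0\\0&-1&0\end{pmatrix},\ \mathbb{B}_5(t)=\begin{pmatrix}t&-1&0\\-1&-1&0\\0&0&1\end{pmatrix},$$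 $$\mathbb{C}_1=\begin{pmatrix}0&-1&0\\0&-1&0\\0&-1&0\end{pmatrix},\ \mathbb{C}_2=\begin{pmatrix}-1&-1&0\\-1&-1&0\\-1&-1&0\end{pmatrix},\ \mathbb{C}_3=\begin{pmatrix}0&0&0\\-1&-1&0\\-1&-1&0\end{pmatrix},\ \mathbb{C}_4=\begin{pmatrix}0&0&1\\-1&-1&0\\0&-1&0\end{pmatrix},$$ $$\mathbb{C}_5=\begin{pmatrix}0&0&1\\-1&-1&0\\-1&-1&0\end{pmatrix},\ \mathbb{C}_6=\begin{pmatrix}1&0&1\\0&-1&0\\0&-1&0\end{pmatrix},\ \mathbb{C}_7=\begin{pmatrix}0&-1&0\\0&-1&0\\1&0&1\end{pmatrix},\ \mathbb{C}_8=\begin{pmatrix}1&0&1\\0&-1&0\\1&0&1\end{pmatrix}.$$ *)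

(* Defs.v *)
From HB Require Import structures.
From mathcomp Require Import all_boot all_order all_algebra.

Set Implicit Arguments.
Unset Strict Implicit.
Unset Printing Implicit Defensive.

Import Order.TTheory GRing.Theory.
Local Open Scope order_scope.

(* Displays carry no mathematical content, so fixing one loses no poset and    *)
(* lets a measure be a function on all finite posets.                          *)
Fact poset_display : Order.disp_t.
Proof. exact: Order.Disp tt tt. Qed.

Notation poset := (finPOrderType poset_display).

Record embedding (P Q : poset) := Embedding {
  emb_fun :> P -> Q;
  emb_inj : injective emb_fun;
  emb_mono : {mono emb_fun : x y / x <= y}
}.

Lemma emb_comp_mono (P Q R : poset) (b : embedding Q R) (a : embedding P Q) :
  {mono b \o a : x y / x <= y}.
Proof. by move=> x y /=; rewrite !emb_mono. Qed.

Definition emb_comp (P Q R : poset) (b : embedding Q R) (a : embedding P Q) :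
    embedding P R :=
  Embedding (inj_comp (@emb_inj _ _ b) (@emb_inj _ _ a))
            (emb_comp_mono b a).

Section Amalgamation.
Variables (P Q P' : poset) (alpha : embedding P Q) (beta : embedding P P').

(* The triple (Q', alpha', beta').                                             *)
Record amalgamation := Amalgamation {
  amal_poset : poset;
  amal_alpha : embedding P' amal_poset;
  amal_beta : embedding Q amal_poset;
  amal_comm : forall x, amal_beta (alpha x) = amal_alpha (beta x);
  amal_cover : forall z,
    (exists y, z = amal_alpha y) \/ (exists y, z = amal_beta y)
}.

Definition amal_iso (A B : amalgamation) : Prop :=
  exists h : embedding (amal_poset A) (amal_poset B),
    [/\ bijective h,
        forall y, h (amal_alpha A y) = amal_alpha B y
      & forall y, h (amal_beta A y) = amal_beta B y].

Definition amal_representatives (r : nat) (A : 'I_r -> amalgamation) : Prop :=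
  (forall B, exists i, amal_iso (A i) B) /\
  (forall i j, amal_iso (A i) (A j) -> i = j).

End Amalgamation.

Record measure (k : fieldType) := Measure {
  measure_fun :> forall P Q : poset, embedding P Q -> k;
  measure_isom : forall (P Q : poset) (a : embedding P Q),
    bijective a -> measure_fun a = 1%R;
  measure_comp : forall (P Q R : poset) (b : embedding Q R) (a : embedding P Q),
    measure_fun (emb_comp b a) = (measure_fun b * measure_fun a)%R;
  measure_amal : forall (P Q P' : poset)
      (alpha : embedding P Q) (beta : embedding P P')
      (r : nat) (A : 'I_r -> amalgamation alpha beta),
    amal_representatives A ->
    measure_fun alpha = (\sum_(i < r) measure_fun (amal_alpha (A i)))%R
}.

Definition removal (P : poset) (x : P) : Type := {y : P | y != x}.
HB.instance Definition _ (P : poset) (x : P) := SubFinite.on (removal x).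
HB.instance Definition _ (P : poset) (x : P) :=
  [SubChoice_isSubPOrder of removal x by <: with poset_display].

Definition removal_emb (P : poset) (x : P) : embedding (removal x) P :=
  @Embedding (removal x) P val val_inj (fun _ _ => erefl).

Definition measure_at (k : fieldType) (nu : measure k) (P : poset) (x : P) : k :=
  nu _ _ (removal_emb x).

Definition empty_poset : Type := void.
HB.instance Definition _ := Finite.on empty_poset.

Section EmptyPoset.
Let le0 (x y : empty_poset) := true.
Let le0_refl : reflexive le0. Proof. by []. Qed.
Let le0_anti : antisymmetric le0. Proof. by case. Qed.
Let le0_trans : transitive le0. Proof. by []. Qed.
HB.instance Definition _ := Order.Le_isPOrder.Build poset_display empty_poset
  le0_refl le0_anti le0_trans.
End EmptyPoset.

Definition empty_emb_fun (P : poset) (x : empty_poset) : P :=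
  match x with end.

Definition empty_emb (P : poset) : embedding empty_poset P :=
  @Embedding empty_poset P (@empty_emb_fun P)
    (fun x : empty_poset => match x with end)
    (fun x : empty_poset => match x with end).

(* None is the point *, Some (inl i) is a_i and Some (inr j) is b_j.           *)
Definition J (p q : nat) : Type := option ('I_p + 'I_q).
HB.instance Definition _ (p q : nat) := Finite.on (J p q).

Definition J_star (p q : nat) : J p q := None.

Definition J_gen (p q : nat) : rel (J p q) := fun x y =>
  match x, y with
  | Some (inl _), None | None, Some (inr _) => true
  | _, _ => false
  end.

Definition J_le (p q : nat) : rel (J p q) := connect (@J_gen p q).

Definition J_level (p q : nat) (x : J p q) : nat :=
  match x with Some (inl _) => 0 | None => 1 | Some (inr _) => 2 end.

Lemma J_leE p q (x y : J p q) :
  J_le x y = (x == y) || (J_level x < J_level y)%N.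
Proof.
apply/idP/orP => [/connectP[s]|[/eqP->|]]; last 2 first.
- exact: connect0.
- case: x y => [[a|b]|] [[a'|b']|] //= _; [|exact: connect1..].
  have le_a : J_le (Some (inl a)) (None : J p q) by apply: connect1.
  have le_b : J_le (None : J p q) (Some (inr b')) by apply: connect1.
  exact: connect_trans le_a le_b.
elim: s x => [|z s IH] x /=; first by move=> _ ->; left.
case/andP=> xz /IH{}IH /IH{IH} zy.
have lt_xz : (J_level x < J_level z)%N by case: x z xz {zy} => [[?|?]|] [[?|?]|].
right; case: zy => [/eqP<- //|]; exact: ltn_trans.
Qed.

Section JPoset.
Variables p q : nat.
Let J_refl : reflexive (@J_le p q). Proof. exact: connect0. Qed.
Let J_anti : antisymmetric (@J_le p q).
Proof.
move=> x y; rewrite !J_leE => /andP[/predU1P[->//|lt_xy]].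
by case/predU1P=> [->//|/(ltn_trans lt_xy)]; rewrite ltnn.
Qed.
Let J_trans : transitive (@J_le p q). Proof. exact: connect_trans. Qed.
HB.instance Definition _ := Order.Le_isPOrder.Build poset_display (J p q)
  J_refl J_anti J_trans.
End JPoset.

Definition measure_mx (k : fieldType) (nu : measure k) : 'M[k]_3 :=
  \matrix_(p < 3, q < 3) measure_at nu (J_star p q).

Definition support (k : fieldType) (nu : measure k) (P : poset) : Prop :=
  nu _ _ (empty_emb P) <> 0%R.

(* Elements of N together with infinity, encoded by None.                      *)
Definition leq_bound (m : nat) (n : option nat) : bool :=
  if n is Some n then (m <= n)%N else true.

Definition classA (n : option nat) (X : poset) : Prop :=
  (forall x y : X, x <= y -> x = y) /\ leq_bound #|X| n.

(* In the next two definitions, X_i is the fibre of c over i.                  *)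
Definition classB (n : option nat) (X : poset) : Prop :=
  exists (m : nat) (c : X -> 'I_m),
    [/\ leq_bound m n,
        forall x y, c x = c y -> x >=< y
      & forall x y, c x <> c y -> x >< y].

Definition classC (n : option nat) (X : poset) : Prop :=
  exists (m : nat) (c : X -> 'I_m),
    [/\ forall x y, c x = c y -> x <= y -> x = y,
        forall i, leq_bound #|[set x | c x == i]| n
      & forall x y, (c x < c y)%N -> x < y].

(* In characteristic 0 the natural number n with n%:R = t is unique if it      *)
(* exists; in characteristic p > 0 such n exist exactly when t lies in the     *)
(* prime subfield, and the least one is the minimal representative of t.       *)
Definition scalar_bound (k : fieldType) (t : k) (n : option nat) : Prop :=
  if n is Some n then
    n%:R%R = t /\ (forall m : nat, m%:R%R = t -> (n <= m)%N)
  else forall m : nat, m%:R%R <> t.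

Definition at_scalar (C : option nat -> poset -> Prop) (k : fieldType) (t : k)
    (X : poset) : Prop :=
  exists2 n, scalar_bound t n & C n X.

Definition mx3 (k : fieldType) (s : seq (seq k)) : 'M[k]_3 :=
  \matrix_(i < 3, j < 3) nth 0%R (nth [::] s i) j.

Section Matrices.
Local Open Scope ring_scope.
Variable k : fieldType.
Implicit Types s t : k.

Definition mxA s t : 'M[k]_3 :=
  mx3 [:: [:: t; 0; 0]; [:: 0; s; s]; [:: 0; s; s]].
Definition mxB1 t : 'M[k]_3 :=
  mx3 [:: [:: t; t; t]; [:: t; t; t]; [:: t; t; t]].
Definition mxB2 t : 'M[k]_3 :=
  mx3 [:: [:: 0; t; t]; [:: 0; t; t]; [:: 0; t; t]].
Definition mxB3 t : 'M[k]_3 :=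
  mx3 [:: [:: t; 0; 0]; [:: 0; -1; 0]; [:: 0; -1; 0]].
Definition mxB4 t : 'M[k]_3 :=
  mx3 [:: [:: t; -1; 0]; [:: -1; -1; 0]; [:: 0; -1; 0]].
Definition mxB5 t : 'M[k]_3 :=
  mx3 [:: [:: t; -1; 0]; [:: -1; -1; 0]; [:: 0; 0; 1]].
Definition mxC1 : 'M[k]_3 :=
  mx3 [:: [:: 0; -1; 0]; [:: 0; -1; 0]; [:: 0; -1; 0]].
Definition mxC2 : 'M[k]_3 :=
  mx3 [:: [:: -1; -1; 0]; [:: -1; -1; 0]; [:: -1; -1; 0]].
Definition mxC3 : 'M[k]_3 :=
  mx3 [:: [:: 0; 0; 0]; [:: -1; -1; 0]; [:: -1; -1; 0]].
Definition mxC4 : 'M[k]_3 :=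
  mx3 [:: [:: 0; 0; 1]; [:: -1; -1; 0]; [:: 0; -1; 0]].
Definition mxC5 : 'M[k]_3 :=
  mx3 [:: [:: 0; 0; 1]; [:: -1; -1; 0]; [:: -1; -1; 0]].
Definition mxC6 : 'M[k]_3 :=
  mx3 [:: [:: 1; 0; 1]; [:: 0; -1; 0]; [:: 0; -1; 0]].
Definition mxC7 : 'M[k]_3 :=
  mx3 [:: [:: 0; -1; 0]; [:: 0; -1; 0]; [:: 1; 0; 1]].
Definition mxC8 : 'M[k]_3 :=
  mx3 [:: [:: 1; 0; 1]; [:: 0; -1; 0]; [:: 1; 0; 1]].

Definition has_matrix (nu : measure k) (M : 'M[k]_3) : Prop :=
  measure_mx nu = M \/ (measure_mx nu)^T = M.

Definition support_is (nu : measure k) (C : poset -> Prop) : Prop :=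
  forall P : poset, support nu P <-> C P.

End Matrices.

(* Main.v *)
Require Import Defs.
From HB Require Import structures.
From mathcomp Require Import all_boot all_order all_algebra.
From mathcomp Require Import boolp.

Set Implicit Arguments.
Unset Strict Implicit.
Unset Printing Implicit Defensive.

Import Order.TTheory GRing.Theory.
Local Open Scope order_scope.

(** Write [weight P] for the measure of the embedding of the empty poset in
    [P]; the support is where it is nonzero.  Multiplicativity makes the support
    closed under passing to subposets.  So two things have to be shown in each
    case: which small posets have weight zero (this gives the shape of the
    posets in the support), and how the weight changes when one point is added
    to a poset of that shape.

    Both come from one identity, [cut_sum].  Let [A] and [B] be antichains of
    [R] with [A < B] elementwise, and let [f p q], which is [Jval nu p q] below,
    be the measure of the removal of the middle point from [J p q].  Take [J #|A| #|B|], without its middle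
    point, to be the subposet [A :|: B] of [R].  In an amalgamation of the
    whole [J #|A| #|B|] with [R] over [A :|: B] the middle point is either
    identified with a point of [R] strictly between [A] and [B], or it is a new
    point, placed in [R] by a cut [(D, U)]: [D] is what lies below it, [U] what
    lies above, with [A] inside [D] and [B] inside [U].  Multiplied by
    [weight R], the amalgamation axiom reads
      [f #|A| #|B| * weight R = n * weight R + sum of weight (R plus the cut)],
    where [n] counts the points between [A] and [B].  Once the small posets of
    weight zero are known, only the cuts that keep the shape contribute, and the
    sum has very few terms, provided that [A] and [B] are chosen well.

    - If [f 0 0 = 0], then points have weight zero and only the empty poset is
      in the support.
    - If [f 0 0 = t] and [f 1 0 = 0], then two-element chains have weight zero.
      Only the new isolated point survives over an antichain of [n] points, and
      adding it multiplies the weight by [t - n].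
    - If [f 0 0 = t] and [f 1 0 = f 0 1 = f 1 1 = -1], then the two posets
      consisting of a point below, or above, two incomparable points have
      weight zero, so the posets in the support are disjoint unions of chains.
      Adding a point to an existing chain multiplies the weight by [-1]; adding
      an isolated point to an antichain of [n] points multiplies it by [t + n],
      because each of the [2 * n] further cuts contributes a factor [-1].
    - If [f p q = t] for [p, q <= 1] and [f 2 0 = t], then the disjoint union of
      a point and a two-element chain has weight zero, so the posets in the
      support are ordinal sums of antichains.  Adding a new level multiplies the
      weight by [t], and enlarging a level of [n] points multiplies it by
      [- (t + n)], because the new point could also have been a level of its own
      just below or just above that level.

    The values of [f] involved are symmetric in each of the matrices, so a
    matrix and its transpose are treated at once, and every matrix falls under
    one of the four cases. *)

(** * Embeddings *)

Lemma embedding_eq (P Q : poset) (e e' : embedding P Q) : e =1 e' -> e = e'.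
Proof.
case: e e' => [f fi fm] [g gi gm] /= fg; have {}fg : f = g by exact/funext.
by case: _ / fg in gi gm *; congr Embedding; exact: Prop_irrelevance.
Qed.

Lemma mono_inj (P Q : poset) (f : P -> Q) :
  {mono f : x y / x <= y} -> injective f.
Proof. by move=> fm x y fxy; apply: le_anti; rewrite -!fm fxy lexx. Qed.

Definition mono_emb (P Q : poset) (f : P -> Q) (fm : {mono f : x y / x <= y}) :
  embedding P Q := Embedding (mono_inj fm) fm.

Lemma emb_lt (P Q : poset) (e : embedding P Q) : {mono e : x y / x < y}.
Proof. by move=> x y; rewrite !lt_def (inj_eq (@emb_inj _ _ e)) emb_mono. Qed.

Lemma surj_bij (P Q : poset) (e : embedding P Q) :
  (forall z, exists y, z = e y) -> bijective e.
Proof.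
move=> /fin_all_exists[g gK]; exists g => [x|y]; last by rewrite -gK.
by apply: (@emb_inj _ _ e); rewrite -gK.
Qed.

(** * One-point extensions *)

(** When [c] is a cut, the point [None] added to [R] lies above [c.1] and below
    [c.2]. *)
Definition ext (R : poset) (c : {set R} * {set R}) : Type := option R.

Section Extension.
Variables (R : poset) (c : {set R} * {set R}).

Definition cut : bool :=
  [forall x, forall y,
    [&& (x <= y) && (y \in c.1) ==> (x \in c.1),
        (x <= y) && (x \in c.2) ==> (y \in c.2)
      & (x \in c.1) && (y \in c.2) ==> (x < y)]].

Lemma cutP : reflect
  [/\ forall x y, x <= y -> y \in c.1 -> x \in c.1,
      forall x y, x <= y -> x \in c.2 -> y \in c.2
    & forall x y, x \in c.1 -> y \in c.2 -> x < y] cut.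
Proof.
apply: (iffP 'forall_forallP) => [cP|[cD cU cDU] x y].
  split=> x y; have /and3P[h1 h2 h3] := cP x y.
  - by move=> xy yc; apply: (implyP h1); rewrite xy.
  - by move=> xy yc; apply: (implyP h2); rewrite xy.
  - by move=> xc yc; apply: (implyP h3); rewrite xc.
by apply/and3P; split; apply/implyP => /andP[]; [exact: cD|exact: cU|exact: cDU].
Qed.

HB.instance Definition _ := Finite.on (ext c).

(** When [c] is not a cut the new point is made incomparable to everything, so
    that [ext c] is a poset for every pair [c]. *)
Definition ext_le : rel (ext c) := fun x y =>
  match x, y with
  | Some a, Some b => a <= b
  | Some a, None => cut && (a \in c.1)
  | None, Some b => cut && (b \in c.2)
  | None, None => true
  end.

Let ext_refl : reflexive ext_le. Proof. by case=> [a|] /=. Qed.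
Let ext_anti : antisymmetric ext_le.
Proof.
move=> [a|] [b|] //=; first by move/le_anti->.
  by case: cutP => //= -[_ _ h] /andP[aD aU]; have := h _ _ aD aU; rewrite ltxx.
by case: cutP => //= -[_ _ h] /andP[aU aD]; have := h _ _ aD aU; rewrite ltxx.
Qed.
Let ext_trans : transitive ext_le.
Proof.
move=> [b|] [a|] [d|] //=; first exact: le_trans.
- by case: cutP => //= -[h _ _] ab; exact: h.
- by case: cutP => //= -[_ h _] ba bd; exact: h bd ba.
- by case: cutP => //= -[_ _ h] aD dU; exact/ltW/h.
Qed.
HB.instance Definition _ := Order.Le_isPOrder.Build poset_display (ext c)
  ext_refl ext_anti ext_trans.

Lemma ext_leSS (a b : R) : ((Some a : ext c) <= Some b) = (a <= b).
Proof. by []. Qed.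
Lemma ext_ltSS (a b : R) : ((Some a : ext c) < Some b) = (a < b).
Proof. by rewrite !lt_def. Qed.
Lemma ext_leSN (a : R) : cut -> ((Some a : ext c) <= None) = (a \in c.1).
Proof. by move=> cc; rewrite /Order.le /= cc. Qed.
Lemma ext_leNS (a : R) : cut -> ((None : ext c) <= Some a) = (a \in c.2).
Proof. by move=> cc; rewrite /Order.le /= cc. Qed.
Lemma ext_ltSN (a : R) : cut -> ((Some a : ext c) < None) = (a \in c.1).
Proof. by move=> cc; rewrite lt_def ext_leSN. Qed.
Lemma ext_ltNS (a : R) : cut -> ((None : ext c) < Some a) = (a \in c.2).
Proof. by move=> cc; rewrite lt_def ext_leNS. Qed.

Definition ext_emb : embedding R (ext c) :=
  @mono_emb R (ext c) (@Some R) (fun _ _ => erefl).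

End Extension.

(** Every one-point extension of [R] comes from a cut: if [e] embeds [R] in [T]
    and [o] is another point of [T], then [ext (cut_of e o)] is the subposet
    formed by the image of [e] and [o]. *)
Section ExtensionMap.
Variables (R T : poset) (e : embedding R T) (o : T).

Definition cut_of : {set R} * {set R} :=
  ([set y | e y < o], [set y | o < e y]).

Lemma cut_of_cut : cut cut_of.
Proof.
apply/cutP; split=> x y; rewrite !inE -?(emb_mono e) -?(emb_lt e).
- exact: le_lt_trans.
- by move=> xy ox; exact: lt_le_trans ox xy.
- exact: lt_trans.
Qed.

Hypothesis oNe : o \notin codom e.

Definition ext_map (z : ext cut_of) : T := if z is Some y then e y else o.

Lemma ext_map_mono : {mono ext_map : x y / x <= y}.
Proof.
have neq y : e y != o by apply: contraNneq oNe => <-; exact: codom_f.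
move=> [a|] [b|] /=; last by rewrite !lexx.
- by rewrite ext_leSS emb_mono.
- by rewrite ext_leSN ?cut_of_cut // inE lt_neqAle neq.
- by rewrite ext_leNS ?cut_of_cut // inE lt_neqAle eq_sym neq.
Qed.

Definition ext_map_emb : embedding (ext cut_of) T := mono_emb ext_map_mono.

End ExtensionMap.

(** * Amalgamations of a one-point extension *)

Section OnePoint.
Variables (Q : poset) (x : Q) (R : poset) (b : embedding (removal x) R).

(** [o] stands to the image of [removal x] in [T] as [x] stands to [removal x],
    so that [x] can be sent to [o]. *)
Definition compatible (T : poset) (j : embedding R T) (o : T) : bool :=
  [forall z : removal x, ((j (b z) <= o) == (val z <= x)) &&
                         ((o <= j (b z)) == (x <= val z))].

Section Glue.
Variables (T : poset) (j : embedding R T) (o : T).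
Hypothesis jo : compatible j o.
Hypothesis joT : forall z, z = o \/ exists y, z = j y.

Definition glue (q : Q) : T :=
  if insub q is Some z then j (b (z : removal x)) else o.

Lemma glue_val (z : removal x) : glue (val z) = j (b z).
Proof. by rewrite /glue valK. Qed.

Lemma glue_pt : glue x = o.
Proof. by rewrite /glue insubF ?eqxx. Qed.

Lemma glue_case (q : Q) : q = x \/ exists z : removal x, q = val z.
Proof.
case: (eqVneq q x) => [->|qx]; [by left|right].
by exists (Sub q qx); rewrite SubK.
Qed.

Lemma glue_mono : {mono glue : p q / p <= q}.
Proof.
move=> p q; case: (glue_case p) => [->|[z ->]];
  case: (glue_case q) => [->|[z' ->]];
  rewrite ?glue_val ?glue_pt ?lexx //.
- by have /forallP/(_ z')/andP[_ /eqP] := jo.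
- by have /forallP/(_ z)/andP[/eqP] := jo.
- by rewrite !emb_mono.
Qed.

Lemma glue_cover z : (exists y, z = j y) \/ (exists y, z = glue y).
Proof.
by case: (joT z) => [->|]; [right; exists x; rewrite glue_pt|left].
Qed.

Definition glue_amal : amalgamation (removal_emb x) b :=
  @Amalgamation _ _ _ (removal_emb x) b T j (mono_emb glue_mono)
    glue_val glue_cover.

End Glue.

(** An amalgamation of [Q] and [R] over [removal x] is determined by the place
    of [x]: a point of [R] with which it is identified, or a cut of [R]. *)
Definition code : Type := (R + ({set R} * {set R}))%type.
HB.instance Definition _ := Finite.on code.

Definition id_emb (P : poset) : embedding P P :=
  @mono_emb P P id (fun _ _ => erefl).

Definition code_ok (s : code) : bool :=
  match s with
  | inl y => compatible (id_emb R) y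
  | inr c => cut c && compatible (ext_emb c) None
  end.

Lemma id_cover (y z : R) : z = y \/ exists y', z = id_emb R y'.
Proof. by right; exists z. Qed.

Lemma ext_cover (c : {set R} * {set R}) (z : ext c) :
  z = None \/ exists y, z = ext_emb c y.
Proof. by case: z => [y|]; [right; exists y|left]. Qed.

Definition code_amal (s : code) : code_ok s -> amalgamation (removal_emb x) b :=
  match s with
  | inl y => fun ok => glue_amal ok (id_cover y)
  | inr c => fun ok => glue_amal (andP ok).2 (@ext_cover c)
  end.

Lemma code_amal_surj (B : amalgamation (removal_emb x) b) :
  exists s (ok : code_ok s), amal_iso (code_amal ok) B.
Proof.
set j := amal_alpha B; set o := amal_beta B x.
have jb z : amal_beta B (val z) = j (b z) by exact: (amal_comm B).
have comp : compatible j o.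
  by apply/forallP => z; rewrite -jb !emb_mono !eqxx.

have cover z : z = o \/ exists y, z = j y.
  case: (amal_cover z) => [|[q ->]]; first by right.
  by case: (glue_case q) => [->|[r ->]]; [left|right; exists (b r)].
case: (boolP (o \in codom j)) => [/codomP[y oy]|oNj].
  have ok : code_ok (inl y).
    apply/forallP => z; have /forallP/(_ z) := comp.
    by rewrite oy !emb_mono.
  exists (inl y), ok, j; split=> //=.
    by apply: (surj_bij (e := j)) => z; case: (cover z) => // ->; exists y.
  move=> q; case: (glue_case q) => [->|[r ->]].
    by rewrite glue_pt.
  by rewrite (glue_val (id_emb R)) /= jb.
have ok : code_ok (inr (cut_of j o)).
  rewrite /= cut_of_cut; apply/forallP => z; have /forallP/(_ z) := comp.
  by rewrite -2!(ext_map_mono oNj).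
exists (inr (cut_of j o)), ok, (ext_map_emb oNj); split=> //=.
  apply: (surj_bij (e := ext_map_emb oNj)) => z.
  case: (cover z) => [->|[y ->]]; first by exists None.
  by exists (Some y).
move=> q; case: (glue_case q) => [->|[r ->]].
  by rewrite glue_pt.
by rewrite (glue_val (ext_emb _)) /= jb.
Qed.

(** An isomorphism of amalgamations fixes [R] and the image of [x], and the code
    only records how these two are related. *)
Lemma code_amal_inj s s' (ok : code_ok s) (ok' : code_ok s') :
  amal_iso (code_amal ok) (code_amal ok') -> s = s'.
Proof.
case=> h [_ hj ho].
have {ho} := ho x.
case: s s' ok ok' h hj => [y|c] [y'|c'] ok ok' h /= hj; rewrite !glue_pt.
- by rewrite hj => ->.
- by rewrite hj.
- by rewrite -(hj y') => /(@emb_inj _ _ h).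
move=> hN; have [cc _] := andP ok; have [cc' _] := andP ok'; congr inr.
have e1 : c.1 = c'.1.
  apply/setP => a; rewrite -(ext_leSN _ cc) -(ext_leSN _ cc').
  by rewrite -(emb_mono h) hj hN.
have e2 : c.2 = c'.2.
  apply/setP => a; rewrite -(ext_leNS _ cc) -(ext_leNS _ cc').
  by rewrite -(emb_mono h) hj hN.
by rewrite [c]surjective_pairing e1 e2 -surjective_pairing.
Qed.

Definition code_rep (i : 'I_#|code_ok|) : amalgamation (removal_emb x) b :=
  code_amal (enum_valP i).

Lemma code_representatives : amal_representatives code_rep.
Proof.
split=> [B|i j /code_amal_inj/enum_val_inj//].
have [s [ok iso]] := code_amal_surj B.
exists (enum_rank_in ok s); rewrite /code_rep.
move: (enum_valP _); rewrite enum_rankK_in // => ok'.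
by rewrite (bool_irrelevance ok' ok).
Qed.

End OnePoint.

(** * Weights and the cut sum *)

Section Weight.
Variables (k : fieldType) (nu : measure k).

Definition weight (P : poset) : k := nu _ _ (empty_emb P).
Definition Jval (p q : nat) : k := measure_at nu (J_star p q).

Lemma weight_emb (P Q : poset) (e : embedding P Q) :
  weight Q = (nu _ _ e * weight P)%R.
Proof.
by rewrite /weight -measure_comp; congr (nu _ _ _); apply: embedding_eq; case.
Qed.

Lemma weight_hereditary (P Q : poset) (e : embedding P Q) :
  weight P = 0%R -> weight Q = 0%R.
Proof. by rewrite (weight_emb e) => ->; rewrite mulr0. Qed.

Lemma weight_iso (P Q : poset) (e : embedding P Q) :
  bijective e -> weight Q = weight P.
Proof. by move=> e_bij; rewrite (weight_emb e) measure_isom // mul1r. Qed.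

Lemma weight_empty (P : poset) : #|P| = 0 -> weight P = 1%R.
Proof.
move=> P0; apply: measure_isom; apply: surj_bij => z.
by have := card0_eq P0 z; rewrite inE.
Qed.

Section OnePointSum.
Variables (Q : poset) (x : Q) (R : poset) (b : embedding (removal x) R).

Definition code_val (s : code R) : k :=
  if s is inr c then nu _ _ (ext_emb c) else 1%R.

Lemma code_amal_val s (ok : code_ok b s) :
  nu _ _ (amal_alpha (code_amal ok)) = code_val s.
Proof.
case: s ok => [y|c] ok //=; apply: measure_isom.
by apply: (surj_bij (e := id_emb R)) => z; exists z.
Qed.

(** The amalgamation axiom for a one-point extension.  An identification
    contributes 1, since [R] is then the whole amalgamation; multiplying by
    [weight R] turns the contribution of a cut into a weight. *)
Lemma one_point_sum :
  (measure_at nu x * weight R =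
   #|[set y | compatible b (id_emb R) y]|%:R * weight R +
   \sum_(c | cut c && compatible b (ext_emb c) None) weight (ext c))%R.
Proof.
rewrite /measure_at (measure_amal nu (code_representatives b)).
under eq_bigr => i _ do rewrite code_amal_val.
have <- := @big_enum_val _ _ _ _ (code_ok b) code_val.
rewrite big_sumType /= mulrDl; congr (_ + _)%R.
  rewrite sumr_const; congr (_%:R * _)%R; apply: eq_card => y.
  by rewrite inE.
rewrite mulr_suml; apply: eq_bigr => c _.
by rewrite (weight_emb (ext_emb c)).
Qed.

End OnePointSum.

Lemma J_orderE p q (x y : J p q) :
  (x <= y) = (x == y) || (J_level x < J_level y)%N.
Proof. exact: J_leE. Qed.

Section CutSum.
Variables (R : poset) (A B : {set R}).
Hypothesis A_anti : forall a a', a \in A -> a' \in A -> a <= a' -> a = a'.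
Hypothesis B_anti : forall b b', b \in B -> b' \in B -> b <= b' -> b = b'.
Hypothesis AB : forall a b, a \in A -> b \in B -> a < b.

Let J := J #|A| #|B|.
Let star : J := J_star #|A| #|B|.

(** The embedding of [J #|A| #|B|] minus its middle point in [R], with image
    [A :|: B]. *)
Definition J_points (z : removal star) : R :=
  match z with
  | exist (Some (inl i)) _ => enum_val i
  | exist (Some (inr j)) _ => enum_val j
  | exist None neq => False_rect R (notF neq)
  end.

Lemma J_points_mono : {mono J_points : x y / x <= y}.
Proof.
move=> [[[i|j]|] //= hx] [[[i'|j']|] //= hy]; 
  rewrite -[RHS](emb_mono (removal_emb star)) [RHS]J_orderE /= ?orbF ?orbT.
- apply/idP/eqP => [|[->]//] /A_anti h.
  by rewrite (enum_val_inj (h (enum_valP _) (enum_valP _))).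
- by apply: ltW; apply: AB; exact: enum_valP.
- apply/negbTE; rewrite lt_geF //; apply: AB; exact: enum_valP.
- apply/idP/eqP => [|[->]//] /B_anti h.
  by rewrite (enum_val_inj (h (enum_valP _) (enum_valP _))).
Qed.

Lemma J_compatible (T : poset) (j : embedding R T) (o : T) :
  compatible (mono_emb J_points_mono) j o =
  [forall a in A, j a < o] && [forall b in B, o < j b].
Proof.
apply/forallP/andP => [h|[/forall_inP hA /forall_inP hB] [[[i|i]|] //= hz]].
- split; apply/forall_inP => a aA.
    have /andP[] := h (Sub (Some (inl (enum_rank_in aA a))) isT).
    rewrite /= enum_rankK_in // => /eqP h1 /eqP h2.
    by move: h1 h2; rewrite lt_leAnge => -> ->; rewrite !J_orderE.
  have /andP[] := h (Sub (Some (inr (enum_rank_in aA a))) isT).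
  rewrite /= enum_rankK_in // => /eqP h1 /eqP h2.
  by move: h1 h2; rewrite lt_leAnge => -> ->; rewrite !J_orderE.
- have := hA _ (enum_valP i); rewrite lt_leAnge => /andP[-> /negbTE->].
  by rewrite !J_orderE.
- have := hB _ (enum_valP i); rewrite lt_leAnge => /andP[-> /negbTE->].
  by rewrite !J_orderE.
Qed.

Lemma cut_sum :
  (Jval #|A| #|B| * weight R =
   #|[set y | [forall a in A, a < y] && [forall b in B, y < b]]%O|%:R * weight R +
   \sum_(c | [&& cut c, A \subset c.1 & B \subset c.2]) weight (ext c))%R.
Proof.
rewrite /Jval (one_point_sum (mono_emb J_points_mono)); congr (_ * _ + _)%R.
  by congr (_%:R)%R; apply: eq_card => y; rewrite !inE J_compatible.
apply: eq_bigl => c; rewrite J_compatible; case: (boolP (cut c)) => //= cc.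
congr andb; apply/forall_inP/subsetP => h y /h.
- by rewrite /= ext_ltSN.
- by rewrite /= ext_ltSN.
- by rewrite /= ext_ltNS.
- by rewrite /= ext_ltNS.
Qed.

End CutSum.

End Weight.

(** * Subposets *)

Definition induced (P : poset) (S : {set P}) : Type := {y : P | y \in S}.
HB.instance Definition _ (P : poset) (S : {set P}) := SubFinite.on (induced S).
HB.instance Definition _ (P : poset) (S : {set P}) :=
  [SubChoice_isSubPOrder of induced S by <: with poset_display].

Definition induced_emb (P : poset) (S : {set P}) : embedding (induced S) P :=
  @mono_emb (induced S) P val (fun _ _ => erefl).

Lemma card_induced (P : poset) (S : {set P}) : #|{: induced S}| = #|S|.
Proof. by rewrite card_sig; apply: eq_card => y; rewrite inE. Qed.

Lemma induced2 (P : poset) (a b : P) (y : induced [set a; b]) :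
  y = Sub a (set21 a b) \/ y = Sub b (set22 a b).
Proof.
by have /set2P[e|e] := valP y; [left|right]; apply: val_inj; rewrite /= e.
Qed.

Lemma card_removal (P : poset) (x : P) : #|P| = #|{: removal x}|.+1.
Proof.
rewrite card_sig (cardD1 x) add1n; congr _.+1.
by apply: eq_card => y; rewrite !inE andbT.
Qed.

Lemma notin_removal (P : poset) (x : P) : x \notin codom (removal_emb x).
Proof. by apply/codomP => -[[y yx] /= xy]; rewrite -xy eqxx in yx. Qed.

Definition removal_cut (P : poset) (x : P) := cut_of (removal_emb x) x.

Definition removal_iso (P : poset) (x : P) :
  embedding (ext (removal_cut x)) P := ext_map_emb (notin_removal x).

Lemma removal_iso_bij (P : poset) (x : P) : bijective (removal_iso x).
Proof.
apply: surj_bij => z; case: (eqVneq z x) => [->|zx]; first by exists None.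
by exists (Some (Sub z zx)).
Qed.

(** * Cuts *)

Section Cuts.
Variable R : poset.
Implicit Types (c : {set R} * {set R}) (A B : {set R}).

Lemma cut_disjoint c y : cut c -> y \in c.1 -> y \in c.2 -> False.
Proof. by case/cutP => _ _ h y1 y2; have := h _ _ y1 y2; rewrite ltxx. Qed.

Lemma cut_eq c c' : cut c -> c'.1 \subset c.1 -> c'.2 \subset c.2 ->
  c.1 :|: c.2 \subset c'.1 :|: c'.2 -> c = c'.
Proof.
move=> cc /subsetP s1 /subsetP s2 /subsetP s.
suff [e1 e2] : c.1 = c'.1 /\ c.2 = c'.2.
  by rewrite [c]surjective_pairing e1 e2 -surjective_pairing.
split; apply/setP => y; apply/idP/idP; [|exact: s1| |exact: s2] => yc.
  have /s : y \in c.1 :|: c.2 by rewrite inE yc.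
  by rewrite inE => /orP[//|/s2/(cut_disjoint cc yc)].
have /s : y \in c.1 :|: c.2 by rewrite inE yc orbT.
by rewrite inE orbC => /orP[//|/s1/(cut_disjoint cc)/(_ yc)].
Qed.

Definition isolated : {set R} * {set R} := (set0, set0).

Lemma isolated_cut : cut isolated.
Proof. by apply/cutP; split=> x y //=; rewrite ?inE. Qed.

Lemma isolatedPn c : c != isolated -> exists y, y \in c.1 :|: c.2.
Proof.
move=> ci; case: (set_0Vmem (c.1 :|: c.2)) => [c0|[y yc]]; last by exists y.
case/eqP: ci; have /eqP := c0; rewrite setU_eq0 => /andP[/eqP e1 /eqP e2].
by rewrite [c]surjective_pairing e1 e2.
Qed.

End Cuts.
Arguments isolated : clear implicits.

(** For a strict order [r], [A] consists of one maximal element of [D], or is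
    empty when [D] is: maximality is expressed by the last clause. *)
Lemma extremal_subset (T : finType) (r : rel T) (D : {set T}) :
  irreflexive r -> transitive r ->
  exists A : {set T}, [/\ #|A| <= 1, A \subset D
    & forall y, y \in D -> exists2 a, a \in A & ~~ r a y]%N.
Proof.
move=> r_irr r_tr; case: (set_0Vmem D) => [->|[y0 y0D]].
  by exists set0; rewrite cards0 sub0set; split=> // y; rewrite inE.
case: (arg_maxnP (fun a => #|[set z | r z a]|) y0D) => a aD amax.
exists [set a]; rewrite cards1 sub1set; split=> // y yD.
exists a; rewrite ?set11 //; apply/negP => ray; have := amax _ yD.
rewrite /= leqNgt => /negP; apply; apply: proper_card; apply/properP; split.
  by apply/subsetP => z; rewrite !inE => /r_tr; apply.
by exists a; rewrite !inE ?ray ?r_irr.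
Qed.

(** [A] holds a maximal element of [c.1] if there is one, and [B] a minimal
    element of [c.2].  Feeding these to [cut_sum] asks the new point to be above
    [A] and below [B], which nearly forces it into the cut [c]. *)
Lemma cut_bounds (R : poset) (c : {set R} * {set R}) :
  exists A B : {set R}, [/\ (#|A| <= 1) && (#|B| <= 1), A \subset c.1, B \subset c.2,
    forall y, y \in c.1 -> exists2 a, a \in A & ~~ (a < y)%O
  & forall y, y \in c.2 -> exists2 b, b \in B & ~~ (y < b)%O]%N.
Proof.
have [A [A1 AD Amax]] := extremal_subset c.1 (@ltxx _ R) (@lt_trans _ R).
have [|z x y h1 h2|B [B1 BU Bmin]] := @extremal_subset R (fun x y => y < x) c.2.
- exact: ltxx.
- exact: lt_trans h2 h1.
by exists A, B; rewrite A1.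
Qed.

Definition antichain (P : poset) : Prop := forall x y : P, x <= y -> x = y.

Lemma antichain_hereditary (P Q : poset) (e : embedding P Q) :
  antichain Q -> antichain P.
Proof. by move=> aQ x y; rewrite -(emb_mono e) => /aQ/(@emb_inj _ _ e). Qed.

Lemma antichain_removal_cut (P : poset) (x : P) :
  antichain P -> removal_cut x = isolated (removal x).
Proof.
move=> aP; have lt0 y z : (y < z :> P) = false.
  by apply/negP => yz; have := aP _ _ (ltW yz) => e; rewrite e ltxx in yz.
by rewrite /removal_cut /cut_of /isolated; congr pair;
  apply/setP => y; rewrite !inE lt0.
Qed.

Lemma antichain_cut (R : poset) (c : {set R} * {set R}) :
  antichain R -> cut c -> c.1 = set0 \/ c.2 = set0.
Proof.
move=> aR /cutP[_ _ h]; case: (set_0Vmem c.1) => [|[y yc]]; first by left.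
right; apply/setP => z; rewrite inE; apply/negP => /(h _ _ yc) yz.
by have := aR _ _ (ltW yz) => e; rewrite e ltxx in yz.
Qed.

Section AntichainSupport.
Variables (k : fieldType) (nu : measure k).
Local Notation weight := (weight nu).
Local Notation Jval := (Jval nu).

Lemma weight_removal (P : poset) (x : P) :
  weight P = weight (ext (removal_cut x)).
Proof. exact: weight_iso (removal_iso_bij x). Qed.

Lemma small_antichain (R : poset) (A : {set R}) : (#|A| <= 1)%N ->
  forall a a', a \in A -> a' \in A -> a <= a' -> a = a'.
Proof. by move=> /card_le1_eqP h a a' aA a'A _; exact: h. Qed.

Lemma cut_sum_unique (R : poset) (A B : {set R}) (c0 : {set R} * {set R}) :
  (#|A| <= 1)%N -> (#|B| <= 1)%N -> cut c0 -> A \subset c0.1 -> B \subset c0.2 ->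
  (forall c, cut c -> A \subset c.1 -> B \subset c.2 ->
    weight (ext c) != 0%R -> c = c0) ->
  (Jval #|A| #|B| * weight R =
   #|[set y | [forall a in A, a < y] && [forall b in B, y < b]]%O|%:R * weight R +
   weight (ext c0))%R.
Proof.
move=> A1 B1 cc0 Ac0 Bc0 uniq; rewrite cut_sum; first last.
- move=> a b /(subsetP Ac0) aD /(subsetP Bc0) bU.
  by case/cutP: cc0 => _ _; apply.
- exact: small_antichain.
- exact: small_antichain.
congr (_ + _)%R; rewrite (bigD1 c0) ?cc0 ?Ac0 //= big1 ?addr0 // => c.
case/andP => /and3P[cc Ac Bc]; apply: contra_neq_eq; exact: uniq.
Qed.

(** * Antichains *)

(** Adding points one at a time to an antichain, the weight first vanishes when
    the number of points already there is [s] in the field. *)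
Lemma antichain_support (s : k) :
  (forall R : poset, antichain R ->
    (weight (ext (isolated R)) != 0%R) =
    (weight R != 0%R) && (#|R|%:R != s)%R) ->
  forall P : poset, antichain P ->
    weight P != 0%R <-> forall i, (i < #|P|)%N -> (i%:R <> s)%R.
Proof.
move=> step P; have [n] := ubnP #|P|; elim: n P => // n IH P.
case: (pickP P) => [x _|P0] lePn aP; last first.
  have P0' : #|P| = 0 by apply: eq_card0.
  by rewrite weight_empty // oner_neq0; split=> // _ i; rewrite P0'.
have aR := antichain_hereditary (removal_emb x) aP.
rewrite (weight_removal x) antichain_removal_cut // step // (card_removal x).
rewrite (card_removal x) ltnS in lePn.
split=> [/andP[/(IH _ lePn aR) h /eqP hs] i|h].
  by rewrite ltnS leq_eqVlt => /orP[/eqP->//|]; exact: h.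
apply/andP; split; last by apply/eqP; apply: h.
by apply/IH => // i iR; apply: h; exact: ltnW.
Qed.

Lemma weight_point0 : Jval 0 0 = 0%R -> forall (P : poset) (x : P), weight P = 0%R.
Proof.
move=> J0 P x; have xN : x \notin codom (empty_emb P) by apply/codomP => -[[]].
apply: (weight_hereditary (ext_map_emb xN)).
have := @cut_sum_unique empty_poset set0 set0 (cut_of (empty_emb P) x).
rewrite !cards0 !sub0set cut_of_cut J0 mul0r => /(_ isT isT isT isT isT).
rewrite [X in (X%:R)%R]eq_card0 ?mul0r ?add0r; last by case.
by move=> -> // c _ _ _ _; rewrite [c]surjective_pairing; congr pair;
  apply/setP; case.
Qed.

Lemma weight_chain0 : Jval 1 0 = 0%R ->
  forall (P : poset) (a b : P), a < b -> weight P = 0%R.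
Proof.
move=> J0 P a b ab; have aS : a \in [set a] by rewrite inE.
set R := induced [set a].
have RE (y : R) : val y = a by apply/set1P/valP.
have bN : b \notin codom (induced_emb [set a]).
  by apply/codomP => -[y /= /esym]; rewrite RE => e; rewrite e ltxx in ab.
apply: (weight_hereditary (ext_map_emb bN)).
set c0 := cut_of _ _; pose a' : R := Sub a aS.
have RE' (y : R) : y = a' by apply: val_inj; rewrite RE SubK.
have ac0 : a' \in c0.1 by rewrite inE.
have := @cut_sum_unique R [set a'] set0 c0.
rewrite cards0 cards1 sub0set sub1set ac0 cut_of_cut J0 mul0r.
move=> /(_ isT isT isT isT isT).
rewrite [X in (X%:R)%R]eq_card0 ?mul0r ?add0r; last first.
  move=> y; rewrite inE; apply/negP => /andP[/forall_inP/(_ a')].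
  by rewrite inE eqxx (RE' y) ltxx => /(_ isT).
move=> -> // c cc; rewrite sub1set => ac _ _; apply: cut_eq => //.
- by apply/subsetP => y; rewrite (RE' y).
- apply/subsetP => y yc; rewrite (RE' y) in yc.
  by case: (cut_disjoint _ ac0 yc); exact: cut_of_cut.
- by apply/subsetP => y _; rewrite inE (RE' y) ac0.
Qed.

Lemma ext_has_lt (R : poset) (c : {set R} * {set R}) (y : R) :
  cut c -> y \in c.1 :|: c.2 -> exists a b : ext c, a < b.
Proof.
move=> cc; rewrite inE => /orP[yc|yc].
  by exists (Some y), None; rewrite ext_ltSN.
by exists None, (Some y); rewrite ext_ltNS.
Qed.

Lemma cut_sum0 (R : poset) :
  (Jval 0 0 * weight R =
   #|R|%:R * weight R + \sum_(c : {set R} * {set R} | cut c) weight (ext c))%R.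
Proof.
have := @cut_sum _ nu R set0 set0; rewrite cards0 => ->.
- congr (_%:R * _ + _)%R; last by apply: eq_bigl => c; rewrite !sub0set !andbT.
  rewrite -cardsT; apply: eq_card => y.
  by rewrite !inE; apply/andP; split; apply/forall_inP => a; rewrite inE.
- by move=> a b; rewrite !inE.
- by move=> a b; rewrite !inE.
- by move=> a b; rewrite !inE.
Qed.

Section ClassA.
Variable t : k.
Hypotheses (J00 : Jval 0 0 = t) (J10 : Jval 1 0 = 0%R).

(** Every cut but the isolated one creates a two-element chain. *)
Lemma classA_isolated (R : poset) :
  weight (ext (isolated R)) = ((t - #|R|%:R) * weight R)%R.
Proof.
have := cut_sum0 R; rewrite J00 (bigD1 (isolated R)) ?isolated_cut //= big1.
  by rewrite addr0 mulrBl => ->; rewrite addrC addKr.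
move=> c /andP[cc /isolatedPn[y yc]].
by have [a [b ab]] := ext_has_lt cc yc; exact: weight_chain0 ab.
Qed.

Lemma classA_support (P : poset) :
  weight P != 0%R <-> antichain P /\ forall i, (i < #|P|)%N -> (i%:R <> t)%R.
Proof.
have H : antichain P ->
    (weight P != 0%R <-> forall i, (i < #|P|)%N -> (i%:R <> t)%R).
  apply: antichain_support => R aR; rewrite classA_isolated mulf_eq0 negb_or.
  by rewrite subr_eq0 andbC [t == _]eq_sym.
split=> [wP|[aP h]]; last exact/(H aP).
suff aP : antichain P by split=> //; exact/(H aP).
move=> x y; rewrite le_eqVlt => /predU1P[//|/(weight_chain0 J10) w0].
by rewrite w0 eqxx in wP.
Qed.

End ClassA.

End AntichainSupport.

(** * Three-element posets of weight zero *)

Section SmallPosets.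
Variables (k : fieldType) (nu : measure k).
Local Notation weight := (weight nu).
Local Notation Jval := (Jval nu).

Section SmallCutSums.
Variable R : poset.

Lemma cut_sum_above (p : R) :
  (\sum_(c | cut c && (p \in c.1)) weight (ext c) =
   Jval 1 0 * weight R - #|[set y | (p < y)%O]|%:R * weight R)%R.
Proof.
have := @cut_sum _ nu R [set p] set0; rewrite cards1 cards0 => ->.
- rewrite addrAC (_ : #|_| = #|[set y | (p < y)%O]|) ?subrr ?add0r.
    by apply: eq_bigl => c; rewrite sub1set sub0set andbT.
  apply: eq_card => y; rewrite !inE; apply/andP/idP => [[/forall_inP/(_ p)]|py].
    by rewrite set11 => /(_ isT).
  by split; apply/forall_inP => a; rewrite inE // => /eqP->.
- by move=> a a'; rewrite !inE => /eqP-> /eqP->.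
- by move=> a b; rewrite !inE.
- by move=> a b _; rewrite inE.
Qed.

Lemma cut_sum_below (q : R) :
  (\sum_(c | cut c && (q \in c.2)) weight (ext c) =
   Jval 0 1 * weight R - #|[set y | (y < q)%O]|%:R * weight R)%R.
Proof.
have := @cut_sum _ nu R set0 [set q]; rewrite cards1 cards0 => ->.
- rewrite addrAC (_ : #|_| = #|[set y | (y < q)%O]|) ?subrr ?add0r.
    by apply: eq_bigl => c; rewrite sub1set sub0set.
  apply: eq_card => y; rewrite !inE; apply/andP/idP => [[_ /forall_inP/(_ q)]|qy].
    by rewrite set11 => /(_ isT).
  by split; apply/forall_inP => a; rewrite inE // => /eqP->.
- by move=> a b; rewrite !inE.
- by move=> a a'; rewrite !inE => /eqP-> /eqP->.
- by move=> a b; rewrite !inE.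
Qed.

Lemma cut_sum_between (p q : R) : p < q ->
  (\sum_(c | [&& cut c, p \in c.1 & q \in c.2]) weight (ext c) =
   Jval 1 1 * weight R - #|[set y | (p < y < q)%O]|%:R * weight R)%R.
Proof.
move=> pq; have := @cut_sum _ nu R [set p] [set q]; rewrite !cards1 => ->.
- rewrite addrAC (_ : #|_| = #|[set y | (p < y < q)%O]|) ?subrr ?add0r.
    by apply: eq_bigl => c; rewrite !sub1set.
  apply: eq_card => y; rewrite !inE.
  apply/andP/andP => [[/forall_inP/(_ p) + /forall_inP/(_ q)]|[py yq]].
    by rewrite !set11 => -> // ->.
  by split; apply/forall_inP => a; rewrite inE // => /eqP->.
- by move=> a a'; rewrite !inE => /eqP-> /eqP->.
- by move=> a a'; rewrite !inE => /eqP-> /eqP->.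
- by move=> a b; rewrite !inE => /eqP-> /eqP->.
Qed.

Lemma cut_sum_above2 (p q : R) : p != q -> ~~ (p <= q) -> ~~ (q <= p) ->
  (\sum_(c | [&& cut c, p \in c.1 & q \in c.1]) weight (ext c) =
   Jval 2 0 * weight R - #|[set y | (p < y)%O && (q < y)%O]|%:R * weight R)%R.
Proof.
move=> pq npq nqp; have := @cut_sum _ nu R [set p; q] set0.
rewrite cards2 pq cards0 => ->.
- rewrite addrAC (_ : #|_| = #|[set y | (p < y)%O && (q < y)%O]|) ?subrr ?add0r.
    by apply: eq_bigl => c; rewrite subUset !sub1set sub0set andbT.
  apply: eq_card => y; rewrite !inE.
  apply/andP/andP => [[/forall_inP h _]|[py qy]].
    by split; apply: h; rewrite !inE eqxx ?orbT.
  by split; apply/forall_inP => a; rewrite !inE // => /orP[] /eqP->.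
- move=> a a'; rewrite !inE => /orP[] /eqP-> /orP[] /eqP-> //.
    by rewrite (negbTE npq).
  by rewrite (negbTE nqp).
- by move=> a b; rewrite !inE.
- by move=> a b _; rewrite inE.
Qed.

Section TwoPoints.
Variables (p q : R).
Hypothesis pqR : forall y, y = p \/ y = q.

Lemma two_point_cut (c c' : {set R} * {set R}) :
  (p \in c.1) = (p \in c'.1) -> (q \in c.1) = (q \in c'.1) ->
  (p \in c.2) = (p \in c'.2) -> (q \in c.2) = (q \in c'.2) -> c = c'.
Proof.
move=> e1 e2 e3 e4.
suff [h1 h2] : c.1 = c'.1 /\ c.2 = c'.2.
  by rewrite [c]surjective_pairing h1 h2 -surjective_pairing.
by split; apply/setP => y; case: (pqR y) => ->.
Qed.

(** A third point above [p] is above [q], between [p] and [q], or incomparable to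
    [q].  Its total is [-2 * weight R], of which the first two kinds take
    [- weight R] each. *)
Lemma weight_V : p < q ->
  Jval 1 0 = (-1)%R -> Jval 1 1 = (-1)%R ->
  cut ([set p], set0) -> weight (ext ([set p], set0 : {set R})) = 0%R.
Proof.
move=> pq J10 J11 c0P; have := cut_sum_above p; have := cut_sum_above q.
have := cut_sum_between pq.
rewrite J10 J11 (_ : [set y | p < y] = [set q]); last first.
  apply/setP => y; rewrite !inE; case: (pqR y) => ->; rewrite ?ltxx ?eqxx //.
  by rewrite lt_eqF.
rewrite (_ : [set y | q < y] = set0); last first.
  by apply/setP => y; rewrite !inE; case: (pqR y) => ->; rewrite ?ltxx // lt_gtF.
rewrite (_ : [set y | p < y < q] = set0); last first.
  by apply/setP => y; rewrite !inE; case: (pqR y) => ->; rewrite ltxx ?andbF.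
rewrite cards1 cards0 mul0r subr0 mul1r mulN1r => S11 Sq.
rewrite (bigID (fun c : {set R} * {set R} => q \in c.1)) /=.
rewrite (_ : (\sum_(c : {set R} * {set R} | _ && (q \in c.1)) _)%R =
  - weight R)%R; last first.
  rewrite -Sq; apply: eq_bigl => c; case: (boolP (cut c)) => //= /cutP[cD _ _].
  by rewrite andbC; case: (boolP (q \in c.1)) => //= /(cD _ _ (ltW pq)).
move=> /addrI; rewrite (bigID (fun c : {set R} * {set R} => q \in c.2)) /=.
rewrite (_ : (\sum_(c : {set R} * {set R} | _ && (q \in c.2)) _)%R =
  - weight R)%R; last first.
  rewrite -S11; apply: eq_bigl => c; case: (boolP (cut c)) => //= cc.
  case: (p \in c.1) => //=; rewrite andbC.
  case: (boolP (q \in c.2)) => //= q2; apply/negP => q1; exact: cut_disjoint q2.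
rewrite -[RHS]addr0 => /addrI <-.
rewrite (big_pred1 ([set p], set0)) // => c /=.
have qp : (q == p) = false by rewrite gt_eqF.
apply/idP/eqP => [|->]; last by rewrite c0P !inE eqxx qp.
case/andP => /andP[/andP[cc p1] q1] q2; apply: two_point_cut.
- by rewrite p1 inE eqxx.
- by rewrite (negbTE q1) inE qp.
- by rewrite inE; apply/negP => /(cut_disjoint cc p1).
- by rewrite inE (negbTE q2).
Qed.

(** Dual to [weight_V], with the points below [q]. *)
Lemma weight_Lambda : p < q ->
  Jval 0 1 = (-1)%R -> Jval 1 1 = (-1)%R ->
  cut (set0, [set q]) -> weight (ext (set0 : {set R}, [set q])) = 0%R.
Proof.
move=> pq J01 J11 c0P; have := cut_sum_below q; have := cut_sum_below p.
have := cut_sum_between pq.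
rewrite J01 J11 (_ : [set y | y < q] = [set p]); last first.
  apply/setP => y; rewrite !inE; case: (pqR y) => ->; rewrite ?ltxx ?eqxx //.
  by rewrite gt_eqF.
rewrite (_ : [set y | y < p] = set0); last first.
  by apply/setP => y; rewrite !inE; case: (pqR y) => ->; rewrite ?ltxx // lt_gtF.
rewrite (_ : [set y | p < y < q] = set0); last first.
  by apply/setP => y; rewrite !inE; case: (pqR y) => ->; rewrite ltxx ?andbF.
rewrite cards1 cards0 mul0r subr0 mul1r mulN1r => S11 Sp.
rewrite (bigID (fun c : {set R} * {set R} => p \in c.2)) /=.
rewrite (_ : (\sum_(c : {set R} * {set R} | _ && (p \in c.2)) _)%R =
  - weight R)%R; last first.
  rewrite -Sp; apply: eq_bigl => c; case: (boolP (cut c)) => //= /cutP[_ cU _].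
  by rewrite andbC; case: (boolP (p \in c.2)) => //= /(cU _ _ (ltW pq)).
move=> /addrI; rewrite (bigID (fun c : {set R} * {set R} => p \in c.1)) /=.
rewrite (_ : (\sum_(c : {set R} * {set R} | _ && (p \in c.1)) _)%R =
  - weight R)%R; last first.
  rewrite -S11; apply: eq_bigl => c; case: (boolP (cut c)) => //= cc.
  rewrite [RHS]andbC; case: (q \in c.2) => //=; rewrite andbC.
  case: (boolP (p \in c.1)) => //= p1; apply/negP; exact: cut_disjoint p1.
rewrite -[RHS]addr0 => /addrI <-.
rewrite (big_pred1 (set0, [set q])) // => c /=.
have pNq : (p == q) = false by rewrite lt_eqF.
apply/idP/eqP => [|->]; last by rewrite c0P !inE eqxx pNq.
case/andP => /andP[/andP[cc q2] p2] p1; apply: two_point_cut.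
- by rewrite inE (negbTE p1).
- by rewrite inE; apply/negP => /(cut_disjoint cc)/(_ q2).
- by rewrite (negbTE p2) inE pNq.
- by rewrite q2 inE eqxx.
Qed.

(** Over two incomparable points, the points above [p] and the points above both
    [p] and [q] have the same total; they differ by the point above [p] only. *)
Lemma weight_2plus1 : p != q -> ~~ (p <= q) -> ~~ (q <= p) ->
  Jval 1 0 = Jval 2 0 ->
  cut ([set p], set0) -> weight (ext ([set p], set0 : {set R})) = 0%R.
Proof.
move=> pNq npq nqp J120 c0P; have := cut_sum_above p.
have := cut_sum_above2 pNq npq nqp.
rewrite (_ : [set y | (p < y) && (q < y)] = [set y | p < y]); last first.
  apply/setP => y; rewrite !inE; case: (pqR y) => ->; rewrite ltxx ?andbF //.
  by rewrite lt_neqAle (negbTE npq) andbF.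
rewrite -J120 => <-.
rewrite (bigID (fun c : {set R} * {set R} => q \in c.1)) /=.
under eq_bigl => c do rewrite -andbA.
rewrite -[RHS]addr0 => /addrI <-.
rewrite (big_pred1 ([set p], set0)) // => c /=.
apply/idP/eqP => [|->]; last by rewrite c0P !inE eqxx eq_sym pNq.
case/andP => /andP[cc p1] q1; apply: two_point_cut.
- by rewrite p1 inE eqxx.
- by rewrite (negbTE q1) inE eq_sym (negbTE pNq).
- by rewrite inE; apply/negP => /(cut_disjoint cc p1).
- rewrite inE; apply/negP => q2; case/cutP: cc => _ _ /(_ _ _ p1 q2)/ltW.
  by rewrite (negbTE npq).
Qed.

End TwoPoints.
End SmallCutSums.

End SmallPosets.

(** * The case of disjoint unions of chains *)

Section ChainSupport.
Variables (k : fieldType) (nu : measure k).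
Local Notation weight := (weight nu).
Local Notation Jval := (Jval nu).

(** Transitivity of comparability characterizes the disjoint unions of chains
    without choosing a decomposition. *)
Definition chains (P : poset) : Prop :=
  forall x y z : P, x >=< y -> y >=< z -> x >=< z.

Lemma emb_comparable (P Q : poset) (e : embedding P Q) :
  {mono e : x y / x >=< y}.
Proof. by move=> x y; rewrite /Order.comparable !emb_mono. Qed.

Lemma chains_hereditary (P Q : poset) (e : embedding P Q) : chains Q -> chains P.
Proof.
by move=> cQ x y z; rewrite -!(emb_comparable e); exact: cQ.
Qed.

Lemma chains_ext (R : poset) (c : {set R} * {set R}) (y z : R) :
  cut c -> chains (ext c) -> z \in c.1 :|: c.2 ->
  (y \in c.1 :|: c.2) = (y >=< z).
Proof.
move=> cc cR zc.
have cN u : ((None : ext c) >=< Some u) = (u \in c.1 :|: c.2).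
  by rewrite /Order.comparable ext_leSN // ext_leNS // inE orbC.
have yz : (y >=< z) = ((Some y : ext c) >=< Some z) by [].
rewrite yz -cN; apply/idP/idP => h.
  by apply: (cR _ None); rewrite ?cN // comparable_sym.
by apply: (cR _ (Some z)); rewrite ?cN // comparable_sym.
Qed.

Section ClassB.
Variable t : k.
Hypotheses (J00 : Jval 0 0 = t) (J10 : Jval 1 0 = (-1)%R)
  (J01 : Jval 0 1 = (-1)%R) (J11 : Jval 1 1 = (-1)%R).

Lemma weight_V_sub (P : poset) (a b c : P) :
  a < b -> a < c -> ~~ (b >=< c) -> weight P = 0%R.
Proof.
move=> ab ac /norP[bc cb].
have cN : c \notin codom (induced_emb [set a; b]).
  apply/codomP => -[[y yS] /= cy]; move: yS; rewrite -cy => /set2P[] e.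
    by rewrite e ltxx in ac.
  by rewrite e lexx in bc.
apply: (weight_hereditary (ext_map_emb cN)).
have := cut_of_cut (induced_emb [set a; b]) c.
rewrite (_ : cut_of _ _ = ([set (Sub a (set21 a b) : induced [set a; b])], set0)).
  by move=> ?; apply: weight_V (@induced2 _ a b) _ _ _ _.
apply: (two_point_cut (@induced2 _ a b)); rewrite !inE /=.
- by rewrite ac eqxx.
- rewrite lt_neqAle (negbTE bc) andbF; apply/esym/eqP => /(congr1 val) /= e.
  by rewrite e ltxx in ab.
- by rewrite lt_gtF.
- by rewrite lt_neqAle (negbTE cb) andbF.
Qed.

Lemma weight_Lambda_sub (P : poset) (a b c : P) :
  a < b -> c < b -> ~~ (a >=< c) -> weight P = 0%R.
Proof.
move=> ab cb /norP[ac ca].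
have cN : c \notin codom (induced_emb [set a; b]).
  apply/codomP => -[[y yS] /= cy]; move: yS; rewrite -cy => /set2P[] e.
    by rewrite e lexx in ac.
  by rewrite e ltxx in cb.
apply: (weight_hereditary (ext_map_emb cN)).
have := cut_of_cut (induced_emb [set a; b]) c.
rewrite (_ : cut_of _ _ = (set0, [set (Sub b (set22 a b) : induced [set a; b])])).
  by move=> ?; apply: weight_Lambda (@induced2 _ a b) _ _ _ _.
apply: (two_point_cut (@induced2 _ a b)); rewrite !inE /=.
- by rewrite lt_neqAle (negbTE ac) andbF.
- by rewrite lt_gtF.
- rewrite lt_neqAle (negbTE ca) andbF; apply/esym/eqP => /(congr1 val) /= e.
  by rewrite e ltxx in ab.
- by rewrite cb eqxx.
Qed.

Lemma weight_chains (P : poset) : weight P != 0%R -> chains P.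
Proof.
move=> wP x y z cxy cyz; apply: contraNT wP => xz; apply/eqP.
have [xy|yx|exy] := comparable_ltgtP cxy; last by rewrite exy cyz in xz.
- have [yz|zy|eyz] := comparable_ltgtP cyz; last by rewrite -eyz cxy in xz.
  + by rewrite /Order.comparable (ltW (lt_trans xy yz)) in xz.
  + exact: weight_Lambda_sub xy zy xz.
- have [yz|zy|eyz] := comparable_ltgtP cyz; last by rewrite -eyz cxy in xz.
  + exact: weight_V_sub yx yz xz.
  + by rewrite /Order.comparable (ltW (lt_trans zy yx)) orbT in xz.
Qed.

(** The new point lies in the chain of some point of [R].  With [A] and [B] its
    neighbours in that chain, [c0] is the only cut between them that keeps a
    disjoint union of chains, and no point of [R] is between them. *)
Lemma classB_extend_chain (R : poset) (c0 : {set R} * {set R}) :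
  cut c0 -> chains (ext c0) -> c0 != isolated R ->
  weight (ext c0) = (- weight R)%R.
Proof.
move=> cc0 ch0 /isolatedPn[y0 y0c].
have [A [B [/andP[A1 B1] /subsetP Ac /subsetP Bc Amax Bmin]]] := cut_bounds c0.
have ABP z : z \in A :|: B -> z \in c0.1 :|: c0.2.
  by rewrite !inE => /orP[/Ac->|/Bc->] //; rewrite orbT.
have [z zAB] : exists z, z \in A :|: B.
  move: y0c; rewrite inE => /orP[/Amax|/Bmin] [z zAB _]; exists z.
    by rewrite inE zAB.
  by rewrite inE zAB orbT.
have := @cut_sum_unique _ nu R A B c0 A1 B1 cc0 (introT subsetP Ac) (introT subsetP Bc).
rewrite (_ : Jval #|A| #|B| = -1)%R; last first.
  have AB0 : (0 < #|A :|: B|)%N by apply/card_gt0P; exists z.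
  have := leq_trans AB0 (leq_card_setU A B); move: A1 B1.
  by case: #|A| => [|[|//]]; case: #|B| => [|[|//]].
rewrite [X in (X%:R)%R]eq_card0; last first.
  move=> y; rewrite inE; apply/negP => /andP[/forall_inP hA /forall_inP hB].
  have : y \in c0.1 :|: c0.2.
    rewrite (chains_ext y cc0 ch0 (ABP _ zAB)) /Order.comparable.
    by move: zAB; rewrite inE => /orP[/hA/ltW->|/hB/ltW->]; rewrite ?orbT.
  rewrite inE => /orP[/Amax|/Bmin] [a /[dup] aAB].
    by move=> /hA ->.
  by move=> /hB ->.
rewrite mulN1r mul0r add0r => -> // c cc /subsetP Ac' /subsetP Bc' /weight_chains ch.
have ABP' u : u \in A :|: B -> u \in c.1 :|: c.2.
  by rewrite !inE => /orP[/Ac'->|/Bc'->] //; rewrite orbT.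
apply: cut_eq => //; apply/subsetP => y yc.
- have [a aA nay] := Amax _ yc; have aAB : a \in A :|: B by rewrite inE aA.
  have /esym := chains_ext y cc0 ch0 (ABP _ aAB).
  rewrite inE yc /= => /comparable_ltgtP[ya|ay|->]; last exact: Ac'.
    by case/cutP: cc => h _ _; apply: h (ltW ya) (Ac' _ aA).
  by rewrite ay in nay.
- have [a aB nay] := Bmin _ yc; have aAB : a \in A :|: B by rewrite inE aB orbT.
  have /esym := chains_ext y cc0 ch0 (ABP _ aAB).
  rewrite inE yc orbT /= => /comparable_ltgtP[ya|ay|->]; last exact: Bc'.
    by rewrite ya in nay.
  by case/cutP: cc => _ h _; apply: h (ltW ay) (Bc' _ aB).
- by rewrite (chains_ext y cc0 ch0 (ABP _ zAB)) -(chains_ext y cc ch (ABP' _ zAB)).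
Qed.

(** Summing [cut_sum_above] over all points of [R] counts each cut [c] with
    multiplicity [#|c.1|], and likewise below; this evaluates the total of the
    cuts other than the isolated one without listing them. *)
Lemma classB_isolated (R : poset) : antichain R ->
  weight (ext (isolated R)) = ((t + #|R|%:R) * weight R)%R.
Proof.
move=> aR.
have lt0 (y z : R) : (y < z) = false.
  by apply/negP => yz; have := aR _ _ (ltW yz) => e; rewrite e ltxx in yz.
pose W c : k := weight (ext (c : {set R} * {set R})).
(* In an extension of nonzero weight the new point is comparable to at most one
   point of [R], so the three coefficients add up to 1. *)
have split_W c : cut c ->
    W c = ((c == isolated R)%:R * W c + (#|c.1|%:R * W c + #|c.2|%:R * W c))%R.
  move=> cc; have [->|w0] := eqVneq (W c) 0%R; first by rewrite !mulr0 !addr0.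
  have ch := weight_chains w0.
  have le1 y z : y \in c.1 :|: c.2 -> z \in c.1 :|: c.2 -> y = z.
    by move=> yc zc; have := chains_ext y cc ch zc; rewrite yc => /esym/orP[]/aR.
  have [ci|ci] := eqVneq c (isolated R).
    by rewrite ci !cards0 !mul0r !addr0 mul1r.
  have [y yc] := isolatedPn ci; rewrite mul0r add0r -mulrDl -natrD.
  suff -> : (#|c.1| + #|c.2| = 1)%N by rewrite mul1r.
  rewrite -cardsUI (_ : c.1 :&: c.2 = set0) ?cards0 ?addn0.
    apply/eqP/cards1P; exists y; apply/setP => z; rewrite inE.
    by apply/idP/eqP => [zc|->//]; exact: le1.
  by case: (antichain_cut aR cc) => ->; rewrite ?set0I ?setI0.
have sum_above : (\sum_(c | cut c) #|c.1|%:R * W c = - (#|R|%:R * weight R))%R.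
  transitivity (\sum_(c : {set R} * {set R} | cut c) \sum_(y in c.1) W c)%R.
    by apply: eq_bigr => c _; rewrite sumr_const mulr_natl.
  rewrite (exchange_big_dep predT) //= (eq_bigr (fun=> - weight R)%R).
    by rewrite sumr_const mulr_natl mulNrn.
  move=> y _; rewrite cut_sum_above J10 mulN1r [X in (X%:R)%R]eq_card0.
    by rewrite mul0r subr0.
  by move=> z; rewrite inE lt0.
have sum_below : (\sum_(c | cut c) #|c.2|%:R * W c = - (#|R|%:R * weight R))%R.
  transitivity (\sum_(c : {set R} * {set R} | cut c) \sum_(y in c.2) W c)%R.
    by apply: eq_bigr => c _; rewrite sumr_const mulr_natl.
  rewrite (exchange_big_dep predT) //= (eq_bigr (fun=> - weight R)%R).
    by rewrite sumr_const mulr_natl mulNrn.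
  move=> y _; rewrite cut_sum_below J01 mulN1r [X in (X%:R)%R]eq_card0.
    by rewrite mul0r subr0.
  by move=> z; rewrite inE lt0.
have := cut_sum0 nu R; rewrite J00 (eq_bigr _ split_W) !big_split /=.
rewrite sum_above sum_below (bigD1 (isolated R)) ?isolated_cut //= eqxx mul1r.
rewrite big1 => [|c /andP[_ /negbTE->]]; last by rewrite mul0r.
by rewrite mulrDl => ->; rewrite addr0 addrCA addNKr subrK.
Qed.

Lemma classB_antichain (P : poset) : antichain P ->
  weight P != 0%R <-> forall i, (i < #|P|)%N -> (i%:R <> - t)%R.
Proof.
apply: antichain_support => R aR; rewrite classB_isolated // mulf_eq0 negb_or.
by rewrite andbC addrC addr_eq0.
Qed.

Lemma classB_support (P : poset) :
  weight P != 0%R <->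
  exists (m : nat) (c : P -> 'I_m), [/\ forall i, (i < m)%N -> (i%:R <> - t)%R,
    forall x y, c x = c y -> x >=< y & forall x y, c x <> c y -> x >< y].
Proof.
split=> [wP|].
  (* The chains are indexed by representatives, which form an antichain, and the
     number of points of an antichain in the support is bounded. *)
  have ch := weight_chains wP.
  pose rep (x : P) := choose (fun y => y >=< x) x.
  have repP x : rep x >=< x.
    by apply: (@chooseP _ (fun y => y >=< x)); exact: comparablexx.
  have rep_eq x y : x >=< y -> rep x = rep y.
    move=> xy; rewrite /rep (@eq_choose _ _ (fun z => z >=< y)).
      by apply: choose_id; [exact: xy|exact: comparablexx].
    move=> z; apply/idP/idP => h; first exact: ch h xy.
    by apply: ch h _; rewrite comparable_sym.
  have repE x y : rep x = rep y -> x >=< y.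
    move=> e; apply: (ch _ (rep x)); first by rewrite comparable_sym.
    by rewrite e.
  pose M := [set rep x | x in P].
  have repM x : rep x \in M by exact: imset_f.
  have aM : antichain (induced M).
    move=> [x xM] [y yM] xy; apply: val_inj => /=.
    have {xy} : x >=< y by rewrite /Order.comparable [x <= y]xy.
    move: xM yM => /imsetP[x' _ ->] /imsetP[y' _ ->] h.
    by apply: rep_eq; apply: (ch _ (rep x')); rewrite 1?comparable_sym //;
       apply: (ch _ (rep y')); rewrite // comparable_sym.
  have wM : weight (induced M) != 0%R.
    by apply: contraNneq wP => w0; rewrite (weight_hereditary (induced_emb M)).
  exists #|{: induced M}|, (fun x => enum_rank (Sub (rep x) (repM x) : induced M)).
  split=> [|x y /enum_rank_inj/(congr1 val)/repE//|x y ne]; first exact/classB_antichain.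
  apply/negP => /rep_eq e; apply: ne; congr enum_rank; exact: val_inj.
(* Points are removed from chains with several points first, so that an
   antichain is what remains. *)
have [n] := ubnP #|P|; elim: n P => // n IH P lePn [m [c [hm c1 c2]]].
have [aP|naP] := boolP [forall x : P, forall y : P, (x >=< y) ==> (x == y)].
  have aP' (x y : P) : x >=< y -> x = y.
    by move=> xy; have /forallP/(_ x)/forallP/(_ y)/implyP/(_ xy)/eqP := aP.
  apply/classB_antichain => [x y xy|i iP].
    by apply: aP'; rewrite /Order.comparable xy.
  apply: hm; apply: leq_trans iP _; rewrite -[m]card_ord.
  by apply: (leq_card c) => x y /c1/aP'.
have [x [y [xy xNy]]] : exists x y : P, x >=< y /\ x != y.
  move: naP => /forallPn[x /forallPn[y]]; rewrite negb_imply => /andP[? ?].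
  by exists x, y.
have chP : chains P.
  move=> u v w uv vw; have cE a b : a >=< b -> c a = c b.
    move=> ab; apply/eqP; apply: contraLR ab => /eqP; exact: c2.
  by apply: c1; rewrite (cE _ _ uv) (cE _ _ vw).
rewrite (weight_removal nu x) classB_extend_chain ?cut_of_cut //; first last.
- apply/eqP => e; have yNx : y != x by rewrite eq_sym.
  have : (Sub y yNx : removal x) \in (removal_cut x).1 :|: (removal_cut x).2.
    by rewrite !inE /=; case/orP: xy => h; rewrite !lt_neqAle h ?xNy ?yNx ?orbT.
  by rewrite e !inE.
- exact: chains_hereditary (removal_iso x) chP.
rewrite oppr_eq0; apply: IH; first by rewrite (card_removal x) in lePn.
exists m, (c \o val); split=> // u v /=; [exact: c1|exact: c2].
Qed.

End ClassB.

End ChainSupport.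

(** * The case of ordinal sums of antichains *)

Section LevelSupport.
Variables (k : fieldType) (nu : measure k).
Local Notation weight := (weight nu).
Local Notation Jval := (Jval nu).

(** This form of the transitivity of incomparability characterizes the ordinal
    sums of antichains without choosing the levels. *)
Definition weak_order (P : poset) : Prop :=
  forall x y z : P, x < y -> (x < z) || (z < y).

Lemma weak_order_hereditary (P Q : poset) (e : embedding P Q) :
  weak_order Q -> weak_order P.
Proof. by move=> wQ x y z; rewrite -!(emb_lt e); exact: wQ. Qed.

(** If [ext c] is a weak order, then [c.1] and [c.2] are unions of levels of [R],
    and the remaining points form at most one level. *)
Section WeakCut.
Variables (R : poset) (c : {set R} * {set R}).
Hypotheses (cc : cut c) (wc : weak_order (ext c)).

Lemma weak_below y z : y \in c.1 -> ~~ (y < z) -> z \in c.1.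
Proof.
rewrite -!ext_ltSN // => yN; have := wc (Some z) yN.
by rewrite ext_ltSS => /orP[->|].
Qed.

Lemma weak_above y z : y \in c.2 -> ~~ (z < y) -> z \in c.2.
Proof.
rewrite -!ext_ltNS // => yN; have := wc (Some z) yN.
by rewrite ext_ltSS => /orP[|->].
Qed.

Lemma weak_level y z : y \notin c.1 :|: c.2 -> z \notin c.1 :|: c.2 -> ~~ (y < z).
Proof.
rewrite !inE => /norP[y1 _] /norP[_ z2]; apply/negP => yz.
have yz' : (Some y : ext c) < Some z by rewrite ext_ltSS.
by have := wc None yz'; rewrite ext_ltSN // ext_ltNS // (negbTE y1) (negbTE z2).
Qed.

End WeakCut.

Section ClassC.
Variable t : k.
Hypotheses (Jt : forall p q, (p <= 1)%N -> (q <= 1)%N -> Jval p q = t)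
  (J20 : Jval 2 0 = t).

Lemma weight_weak (P : poset) : weight P != 0%R -> weak_order P.
Proof.
move=> wP a b c ab; apply: contraNT wP => /norP[ac cb]; apply/eqP.
have cNa : c != a by apply: contraNneq cb => ->.
have nac : ~~ (a <= c) by rewrite le_eqVlt eq_sym (negbTE cNa).
have nca : ~~ (c <= a) by apply: contraNN cb => ca; exact: le_lt_trans ab.
have nbc : ~~ (b < c) by apply: contraNN ac; exact: lt_trans.
have bN : b \notin codom (induced_emb [set a; c]).
  apply/codomP => -[[y yS] /= e]; move: yS; rewrite -e => /set2P[] e'.
    by rewrite e' ltxx in ab.
  by rewrite -e' ab in ac.
apply: (weight_hereditary (ext_map_emb bN)).
have := cut_of_cut (induced_emb [set a; c]) b.
rewrite (_ : cut_of _ _ = ([set (Sub a (set21 a c) : induced [set a; c])], set0)).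
  move=> ?; apply: weight_2plus1 (@induced2 _ a c) _ nac nca _ _ => //.
    by rewrite -(inj_eq val_inj) /= eq_sym.
  by rewrite J20 Jt.
apply: (two_point_cut (@induced2 _ a c)); rewrite !inE /=.
- by rewrite ab eqxx.
- rewrite (negbTE cb); apply/esym/eqP => /(congr1 val) /= /eqP.
  by rewrite (negbTE cNa).
- by rewrite lt_gtF.
- by rewrite (negbTE nbc).
Qed.

(** The new point is a level of its own.  Any cut with [A] below and [B] above
    that gives a weak order contains [c0] part by part, so it is [c0] when the
    parts of [c0] cover [R]. *)
Lemma classC_new_level (R : poset) (c0 : {set R} * {set R}) :
  cut c0 -> c0.1 :|: c0.2 = setT -> weight (ext c0) = (t * weight R)%R.
Proof.
move=> cc0 c0T.
have [A [B [/andP[A1 B1] Ac Bc Amax Bmin]]] := cut_bounds c0.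
have := cut_sum_unique (nu := nu) A1 B1 cc0 Ac Bc; rewrite Jt // => ->; last first.
  move=> c cc /subsetP Ac' /subsetP Bc' /weight_weak wc.
  apply: cut_eq => //; last by rewrite c0T subsetT.
    by apply/subsetP => y /Amax[a /Ac' aA]; exact: (weak_below cc wc aA).
  by apply/subsetP => y /Bmin[b /Bc' bB]; exact: (weak_above cc wc bB).
rewrite [X in (X%:R)%R]eq_card0 ?mul0r ?add0r // => y.
rewrite inE; apply/negP => /andP[/forall_inP hA /forall_inP hB].
have : y \in c0.1 :|: c0.2 by rewrite c0T inE.
by rewrite inE => /orP[/Amax[a /hA->]|/Bmin[b /hB->]].
Qed.

(** The new point joins the level [L].  Between the levels below and above [L],
    the middle point may be one of the points of [L], join [L], or be a new
    level just above or just below [L]; the last two contribute [t] each, so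
    [t = #|L| + x + 2 * t], where [x] is the factor sought. *)
Lemma classC_old_level (R : poset) (c0 : {set R} * {set R}) :
  cut c0 -> weak_order (ext c0) -> c0.1 :|: c0.2 != setT ->
  weight (ext c0) = (- (t + #|~: (c0.1 :|: c0.2)|%:R) * weight R)%R.
Proof.
move=> cc0 wc0; set L := ~: (c0.1 :|: c0.2); rewrite -subTset => /subsetPn[l0 _].
rewrite -in_setC -/L => l0L.
have LE y : (y \in L) = (y \notin c0.1) && (y \notin c0.2) by rewrite !inE negb_or.
have [A [B [/andP[A1 B1] Ac Bc Amax Bmin]]] := cut_bounds c0.
have AB a b : a \in A -> b \in B -> a < b.
  by move=> /(subsetP Ac) aD /(subsetP Bc) bU; case/cutP: cc0 => _ _; apply.
have := cut_sum nu (small_antichain A1) (small_antichain B1) AB; rewrite Jt //.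
have -> : [set y | [forall a in A, a < y] && [forall b in B, y < b]] = L.
  apply/setP => y; rewrite LE inE; apply/idP/idP.
    move=> /andP[/forall_inP hA /forall_inP hB].
    by apply/andP; split; apply/negP; [move=> /Amax[a /hA->]|move=> /Bmin[b /hB->]].
  move=> /andP[y1 y2]; apply/andP; split; apply/forall_inP => a.
    by move=> /(subsetP Ac) aD; apply: contraNT y1; exact: (weak_below cc0 wc0 aD).
  by move=> /(subsetP Bc) aU; apply: contraNT y2; exact: (weak_above cc0 wc0 aU).
have [cD cU cDU] := cutP _ cc0.
(* [c1] and [c2] put the new point just above and just below [L]. *)
pose c1 : {set R} * {set R} := (c0.1 :|: L, c0.2).
pose c2 : {set R} * {set R} := (c0.1, c0.2 :|: L).
have cc1 : cut c1.
  apply/cutP; split=> [x y xy|//|x y]; rewrite /= !in_setU.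
    have [x2|x2] := boolP (x \in c0.2).
      by have y2 := cU _ _ xy x2; rewrite LE y2 andbF orbF => /(cut_disjoint cc0)/(_ y2).
    by rewrite !LE x2 andbT orbN.
  move=> /orP[/cDU/[apply]//|]; rewrite LE => /andP[_ x2] y2.
  by apply: contraNT x2; exact: (weak_above cc0 wc0 y2).
have cc2 : cut c2.
  apply/cutP; split=> [//|x y xy|x y x1]; rewrite /= !in_setU.
    have [y1|y1] := boolP (y \in c0.1).
      by have x1 := cD _ _ xy y1; rewrite LE x1 orbF => /(cut_disjoint cc0 x1).
    by rewrite !LE y1 /= orbN.
  move=> /orP[/cDU-> //|]; rewrite LE => /andP[y1 _].
  by apply: contraNT y1; exact: (weak_below cc0 wc0 x1).
have l0N : (l0 \notin c0.1) && (l0 \notin c0.2) by rewrite -LE.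
have c01 : c1 != c0.
  apply/eqP => /(congr1 (fun c : {set R} * {set R} => l0 \in c.1)) /=.
  rewrite in_setU l0L orbT => /esym l1.
  by rewrite l1 in l0N.
have c02 : c2 != c0.
  apply/eqP => /(congr1 (fun c : {set R} * {set R} => l0 \in c.2)) /=.
  rewrite in_setU l0L orbT => /esym l1.
  by rewrite l1 andbF in l0N.
have c12 : c2 != c1.
  apply/eqP => /(congr1 (fun c : {set R} * {set R} => l0 \in c.1)) /=.
  rewrite in_setU l0L orbT => l1.
  by rewrite l1 in l0N.
have sub1 (c : {set R} * {set R}) :
    A \subset c.1 -> cut c -> weak_order (ext c) -> c0.1 \subset c.1.
  move=> /subsetP Ac' cc wc.
  by apply/subsetP => y /Amax[a /Ac' aA]; exact: (weak_below cc wc aA).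
have sub2 (c : {set R} * {set R}) :
    B \subset c.2 -> cut c -> weak_order (ext c) -> c0.2 \subset c.2.
  move=> /subsetP Bc' cc wc.
  by apply/subsetP => y /Bmin[a /Bc' aA]; exact: (weak_above cc wc aA).
have level := weak_level cc0 wc0.
rewrite (bigD1 c0) /=; last by rewrite cc0 Ac Bc.
rewrite (bigD1 c1) /=; last by rewrite cc1 c01 Bc (subset_trans Ac) ?subsetUl.
rewrite (bigD1 c2) /=; last by rewrite cc2 c02 c12 Ac (subset_trans Bc) ?subsetUl.
have LT : c0.1 :|: c0.2 :|: L = setT by rewrite setUCr.
rewrite big1 ?addr0 => [|c].
  rewrite (@classC_new_level _ c1) //=; last by rewrite setUAC.
  rewrite (@classC_new_level _ c2) //=; last by rewrite setUA.
  rewrite opprD mulrDl !mulNr.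
  move: (t * _)%R (#|L|%:R * _)%R (weight (ext c0)) => X Y W e.
  apply: (addrI (Y + (X + X))%R).
  by rewrite [RHS]addrCA [in RHS](addrC Y) addrK addKr -addrA [(_ + W)%R]addrC -e.
case/andP => /andP[/andP[/and3P[cc Ac' Bc'] ne0] ne1] ne2.
have [//|/weight_weak wc] := eqVneq (weight (ext c)) 0%R.
have s1 := sub1 _ Ac' cc wc; have s2 := sub2 _ Bc' cc wc.
have levelL y z : y \in L -> z \in L -> ~~ (y < z).
  by rewrite !inE => yL zL; apply: level; rewrite inE.
have [/exists_inP[l lL l1]|/exists_inPn L1] := boolP [exists l in L, l \in c.1].
  case/eqP: ne1; apply: cut_eq => //=; last by rewrite setUAC LT subsetT.
  rewrite subUset s1; apply/subsetP => y yL.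
  by apply: (weak_below cc wc l1); exact: levelL.
have [/exists_inP[l lL l2]|/exists_inPn L2] := boolP [exists l in L, l \in c.2].
  case/eqP: ne2; apply: cut_eq => //=; last by rewrite setUA LT subsetT.
  rewrite subUset s2; apply/subsetP => y yL.
  by apply: (weak_above cc wc l2); exact: levelL.
case/eqP: ne0; apply: cut_eq => //; apply/subsetP => y yc; apply: contraLR yc.
by rewrite -in_setC => yL; rewrite inE negb_or L1 // L2.
Qed.

Lemma classC_antichain (P : poset) : antichain P ->
  weight P != 0%R <-> forall i, (i < #|P|)%N -> (i%:R <> - t)%R.
Proof.
apply: antichain_support => R aR.
have [R0|/card_gt0P[y0 _]] := posnP #|R|.
  rewrite classC_new_level ?isolated_cut // => [|]; last first.
    by apply/setP => y; have := card0_eq R0 y; rewrite inE.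
  by rewrite R0 mulf_eq0 negb_or andbC -addr_eq0 add0r.
rewrite classC_old_level ?isolated_cut //=; first last.
- by apply/eqP => /setP/(_ y0); rewrite !inE.
- have lt0 (y z : R) : (y < z) = false.
    by apply/negP => yz; have := aR _ _ (ltW yz) => e; rewrite e ltxx in yz.
  move=> [x|] [y|] z; rewrite ?ltxx ?ext_ltSS ?lt0 //.
    by rewrite ext_ltSN ?isolated_cut // inE.
  by rewrite ext_ltNS ?isolated_cut // inE.
rewrite setU0 setC0 cardsT mulf_eq0 negb_or oppr_eq0 andbC.
by rewrite addrC addr_eq0.
Qed.

Lemma classC_support (P : poset) :
  weight P != 0%R <->
  exists (m : nat) (c : P -> 'I_m), [/\ forall x y, c x = c y -> x <= y -> x = y,
    forall i j, (j < #|[set x | c x == i]|)%N -> (j%:R <> - t)%R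
  & forall x y, (c x < c y)%N -> x < y].
Proof.
split=> [wP|].
  have wk := weight_weak wP.
  (* Points of the same level have the same number of points below them. *)
  pose rk (x : P) := #|[set z | z < x]|.
  have rk_lt (x : P) : (rk x < #|P|)%N.
    rewrite -cardsT; apply: proper_card; apply/properP; split; first exact: subsetT.
    by exists x; rewrite !inE ?ltxx.
  have lt_rk (x y : P) : x < y -> (rk x < rk y)%N.
    move=> xy; apply: proper_card; apply/properP; split.
      by apply/subsetP => z; rewrite !inE => /lt_trans; apply.
    by exists x; rewrite !inE ?xy ?ltxx.
  exists #|P|, (fun x => Ordinal (rk_lt x)); split.
  - move=> x y /(congr1 val) /= e; rewrite le_eqVlt => /predU1P[//|/lt_rk].
    by rewrite e ltnn.
  - move=> i; set S := [set x | _]; rewrite -card_induced; apply/classC_antichain.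
      move=> [x xS] [y yS] xy; apply: val_inj => /=; apply: contraTeq xy => ne.
      apply/negP => xy; have {xy} : x < y by rewrite lt_neqAle ne.
      move: xS yS; rewrite !inE => /eqP/(congr1 val)/= xi /eqP/(congr1 val)/= yi.
      by move=> /lt_rk; rewrite xi yi ltnn.
    by apply: contraNneq wP => w0; rewrite (weight_hereditary (induced_emb S)).
  - move=> x y /= rxy; have : ~~ ([set z | z < y] \subset [set z | z < x]).
      by apply: contraL rxy => /subset_leq_card; rewrite -leqNgt.
    move=> /subsetPn[z]; rewrite !inE => zy zx.
    by have := wk _ _ x zy; rewrite (negbTE zx).
have [n] := ubnP #|P|; elim: n P => // n IH P lePn [m [c [c1 hm c2]]].
have cle (x y : P) : x < y -> (c x < c y)%N.
  move=> xy; rewrite ltn_neqAle leqNgt; apply/andP; split.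
    by apply/eqP => /ord_inj/c1/(_ (ltW xy)) e; rewrite e ltxx in xy.
  by apply/negP => /c2 yx; have := lt_trans xy yx; rewrite ltxx.
have wkP : weak_order P.
  move=> x y z /cle xy; case: (ltnP (c x) (c z)) => [/c2-> //|zx].
  by rewrite (c2 z y) ?orbT //; exact: leq_ltn_trans zx xy.
case: (pickP P) => [x _|P0]; last by rewrite weight_empty ?oner_neq0 // eq_card0.
have wR : weight (removal x) != 0%R.
  apply: IH; first by rewrite (card_removal x) in lePn.
  exists m, (c \o val); split=> [u v /= /c1 h /h/val_inj//| |u v /=/c2//].
  move=> i j jS; apply: (hm i); apply: leq_trans jS _.
  rewrite -(card_imset _ val_inj); apply/subset_leq_card/subsetP => u.
  by case/imsetP => v; rewrite !inE => cv ->.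
have fibre_x : (0 < #|[set y | c y == c x]|)%N.
  by apply/card_gt0P; exists x; rewrite inE.
have t0 : t != 0%R.
  by have /eqP := hm _ _ fibre_x; rewrite eq_sym oppr_eq0.
have cc0 : cut (removal_cut x) by exact: cut_of_cut.
rewrite (weight_removal nu x).
have [c0T|c0T] := eqVneq ((removal_cut x).1 :|: (removal_cut x).2) setT.
  by rewrite (classC_new_level cc0 c0T) mulf_neq0.
rewrite (classC_old_level cc0 _ c0T); last first.
  exact: weak_order_hereditary (removal_iso x) wkP.
rewrite mulf_neq0 // oppr_eq0 addrC addr_eq0; apply/eqP; apply: (hm (c x)).
set L := ~: _; rewrite (cardsD1 x) inE eqxx add1n ltnS -(card_imset _ val_inj).
apply/subset_leq_card/subsetP => u /imsetP[v vL ->].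
move: vL; rewrite !inE /= => /norP[vx xv]; rewrite (valP v) /=.
apply/eqP; apply: ord_inj; apply: anti_leq.
rewrite [X in X && _]leqNgt [X in _ && X]leqNgt.
by apply/andP; split; apply/negP => /c2 h; [rewrite h in xv|rewrite h in vx].
Qed.

End ClassC.

End LevelSupport.

(** * Reading the classes off the matrix *)

Lemma scalar_bound_exists (k : fieldType) (t : k) : exists n, scalar_bound t n.
Proof.
have [[n nt]|no] := pselect (exists n : nat, n%:R%R = t); last first.
  by exists None => n nt; apply: no; exists n.
have ex : exists n : nat, (n%:R == t)%R by exists n; apply/eqP.
case: (ex_minnP ex) => m /eqP mt m_min; exists (Some m); split=> // n' /eqP.
exact: m_min.
Qed.

(** The bound encoded by [n] says that adding points one at a time never reaches
    a number equal to [t] in the field, as the recursions for the weight do. *)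
Lemma leq_boundP (k : fieldType) (t : k) (n : option nat) (m : nat) :
  scalar_bound t n -> leq_bound m n <-> forall i, (i < m)%N -> (i%:R <> t)%R.
Proof.
case: n => [n [nt n_min]|no] /=; last by split=> // _ i _; exact: no.
split=> [mn i im /n_min ni|h]; last by rewrite leqNgt; apply/negP => /h.
by have := leq_trans (leq_ltn_trans ni im) mn; rewrite ltnn.
Qed.

Lemma scalar_bound_uniq (k : fieldType) (t : k) (n n' : option nat) (m : nat) :
  scalar_bound t n -> scalar_bound t n' -> leq_bound m n -> leq_bound m n'.
Proof. by move=> nt nt' /(leq_boundP m nt)/(leq_boundP m nt'). Qed.

Lemma scalar_bound1 (k : fieldType) : scalar_bound (1%R : k) (Some 1).
Proof. by split=> // -[/esym/eqP|//]; rewrite oner_eq0. Qed.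

Section Classification.
Variables (k : fieldType) (nu : measure k).
Local Notation weight := (weight nu).
Local Notation Jval := (Jval nu).

Lemma supportE (P : poset) : Defs.support nu P <-> weight P != 0%R.
Proof. by split=> /eqP. Qed.

(** At a symmetric pair of entries the measure takes the same value whether the
    matrix or its transpose is given. *)
Lemma mx3_val (s : seq (seq k)) (p q : nat) : has_matrix nu (mx3 s) ->
  (p < 3)%N -> (q < 3)%N ->
  nth 0%R (nth [::] s p) q = nth 0%R (nth [::] s q) p ->
  Jval p q = nth 0%R (nth [::] s p) q.
Proof.
move=> h p3 q3; have e i j : mx3 s i j = nth 0%R (nth [::] s i) j by rewrite mxE.
have := e (Ordinal p3) (Ordinal q3); have := e (Ordinal q3) (Ordinal p3).
by case: h => <-; rewrite !mxE /= => <- <- // ->.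
Qed.

Lemma support_A0 : Jval 0 0 = 0%R -> support_is nu (classA (Some 0)).
Proof.
move=> J00 P; rewrite supportE; split=> [wP|[_]].
  have P0 (x : P) : False by move: wP; rewrite (weight_point0 J00 x) eqxx.
  by split=> [x|]; [case: (P0 x)|rewrite /= leqn0; apply/eqP/eq_card0 => x; case: (P0 x)].
by rewrite /= leqn0 => /eqP P0; rewrite weight_empty // oner_neq0.
Qed.

Lemma support_A (t : k) : Jval 0 0 = t -> Jval 1 0 = 0%R ->
  support_is nu (at_scalar classA t).
Proof.
move=> J00 J10 P; rewrite supportE (classA_support J00 J10); split.
  move=> [aP h]; have [n nt] := scalar_bound_exists t.
  by exists n => //; split=> //; exact: (leq_boundP _ nt).2 h.
by move=> [n nt [aP Pn]]; split=> //; exact: (leq_boundP _ nt).1 Pn.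
Qed.

Lemma support_B (t : k) : Jval 0 0 = t -> Jval 1 0 = (-1)%R ->
  Jval 0 1 = (-1)%R -> Jval 1 1 = (-1)%R ->
  support_is nu (at_scalar classB (- t)%R).
Proof.
move=> J00 J10 J01 J11 P; rewrite supportE (classB_support J00 J10 J01 J11); split.
  move=> [m [c [h c1 c2]]]; have [n nt] := scalar_bound_exists (- t)%R.
  by exists n => //; exists m, c; split=> //; exact: (leq_boundP _ nt).2 h.
move=> [n nt [m [c [mn c1 c2]]]]; exists m, c.
by split=> //; exact: (leq_boundP _ nt).1 mn.
Qed.

Lemma support_C (t : k) :
  (forall p q, (p <= 1)%N -> (q <= 1)%N -> Jval p q = t) -> Jval 2 0 = t ->
  support_is nu (at_scalar classC (- t)%R).
Proof.
move=> J J20 P; rewrite supportE (classC_support J J20); split.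
  move=> [m [c [c1 h c2]]]; have [n nt] := scalar_bound_exists (- t)%R.
  by exists n => //; exists m, c; split=> // i; exact: (leq_boundP _ nt).2 (h i).
move=> [n nt [m [c [c1 mn c2]]]]; exists m, c.
by split=> // i; exact: (leq_boundP _ nt).1 (mn i).
Qed.

Lemma support_A1 : Jval 0 0 = 1%R -> Jval 1 0 = 0%R ->
  support_is nu (classA (Some 1)).
Proof.
move=> J00 J10 P; rewrite (support_A J00 J10); have t1 := scalar_bound1 k.
split=> [[n nt [aP Pn]]|CP]; last by exists (Some 1).
by split=> //; exact: scalar_bound_uniq nt t1 Pn.
Qed.

Lemma support_B1 : Jval 0 0 = (-1)%R -> Jval 1 0 = (-1)%R ->
  Jval 0 1 = (-1)%R -> Jval 1 1 = (-1)%R -> support_is nu (classB (Some 1)).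
Proof.
move=> J00 J10 J01 J11 P; rewrite (support_B J00 J10 J01 J11) opprK.
have t1 := scalar_bound1 k.
split=> [[n nt [m [c [mn c1 c2]]]]|CP]; last by exists (Some 1).
by exists m, c; split=> //; exact: scalar_bound_uniq nt t1 mn.
Qed.

End Classification.

Theorem theorem8p4 (k : fieldType) (nu : measure k) :
  (forall s t : k, has_matrix nu (mxA s t) -> support_is nu (at_scalar classA t)) /\
  (forall t : k, has_matrix nu (mxB1 t) -> support_is nu (at_scalar classC (- t)%R)) /\
  (forall t : k, has_matrix nu (mxB2 t) -> support_is nu (classA (Some 0))) /\
  (forall t : k, has_matrix nu (mxB3 t) -> support_is nu (at_scalar classA t)) /\
  (forall t : k, has_matrix nu (mxB4 t) -> support_is nu (at_scalar classB (- t)%R)) /\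
  (forall t : k, has_matrix nu (mxB5 t) -> support_is nu (at_scalar classB (- t)%R)) /\
  (has_matrix nu (mxC1 k) -> support_is nu (classA (Some 0))) /\
  (has_matrix nu (mxC2 k) -> support_is nu (classB (Some 1))) /\
  (has_matrix nu (mxC3 k) -> support_is nu (classA (Some 0))) /\
  (has_matrix nu (mxC4 k) -> support_is nu (classA (Some 0))) /\
  (has_matrix nu (mxC5 k) -> support_is nu (classA (Some 0))) /\
  (has_matrix nu (mxC6 k) -> support_is nu (classA (Some 1))) /\
  (has_matrix nu (mxC7 k) -> support_is nu (classA (Some 0))) /\
  (has_matrix nu (mxC8 k) -> support_is nu (classA (Some 1))).
Proof.
pose val s p q := @mx3_val k nu s p q.
split=> [s t h|].
  by apply: support_A; [exact: (val _ 0 0 h)|exact: (val _ 1 0 h)].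
split=> [t h|].
  apply: support_C; last exact: (val _ 2 0 h).
  by move=> [|[|//]] [|[|//]] _ _; exact: (val _ _ _ h).
split=> [t h|]; first exact/support_A0/(val _ 0 0 h).
split=> [t h|].
  by apply: support_A; [exact: (val _ 0 0 h)|exact: (val _ 1 0 h)].
split=> [t h|]; first by apply: support_B; exact: (val _ _ _ h).
split=> [t h|]; first by apply: support_B; exact: (val _ _ _ h).
split=> [h|]; first exact/support_A0/(val _ 0 0 h).
split=> [h|]; first by apply: support_B1; exact: (val _ _ _ h).
split=> [h|]; first exact/support_A0/(val _ 0 0 h).
split=> [h|]; first exact/support_A0/(val _ 0 0 h).
split=> [h|]; first exact/support_A0/(val _ 0 0 h).
split=> [h|]; first by apply: support_A1; exact: (val _ _ _ h).
split=> h; first exact/support_A0/(val _ 0 0 h).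
by apply: support_A1; exact: (val _ _ _ h).
Qed.
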